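(* Let $n\in\mathbb N$, $p>n$ and $\alpha\in(0,n)$. Set $\sigma=\frac{p\alpha}{p+\alpha-n}$ and let $\gamma>1+\sigma$. Let $\phi$ be a gauge function such that $\phi(r)\sim r^\sigma(\log\frac1r)^\gamma$ near zero. Then there exist a map $u\in V^{1,p}(\mathbb R^n,\mathbb R^n)$ and a compact set $E\subset\mathbb R^n$ such that $0<\mathscr H^\alpha(E)<\infty$ and $\mathscr H^\phi(u(E))=\infty$.
   Context: A gauge function is an increasing continuous function $\phi\colon[0,\infty)\to[0,\infty)$ vanishing only at $0$. For $E\subset\mathbb R^k$, $\mathscr H^\phi(E)=\lim_{\sigma\to0^+}\inf\{\sum_i\phi(d(E_i)): d(E_i)\le\sigma, E\subset\bigcup_iE_i\}$ ($d$ = diameter); $\mathscr H^\alpha$ is the case $\phi(r)=r^\alpha$. $V^{1,p}(\mathbb R^n,\mathbb R^n)$ is the space of weakly differentiable $u\in L^1_{\rm loc}$ with $|\nabla u|\in L^p(\mathbb R^n)$ (continuous representative used). ''$f\sim g$ near zero'' means $c^{-1}g\le f\le cg$ on some interval $(0,r_0)$ for some constant $c>0$. *)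

(* Defs.v *)
From HB Require Import structures.
From mathcomp Require Import all_boot all_order all_algebra.
From mathcomp Require Import all_classical all_reals all_analysis.
Set Implicit Arguments. Unset Strict Implicit. Unset Printing Implicit Defensive.
Import Order.TTheory GRing.Theory Num.Theory.
Import numFieldNormedType.Exports.
Local Open Scope classical_set_scope.
Local Open Scope ring_scope.

Section Defs.
Variable R : realType.

(* Euclidean norm on R^k = 'rV[R]_k (mathcomp's own norm on rows is the
   sup norm; the paper uses the Euclidean distance). *)
Definition enorm (k : nat) (v : 'rV[R]_k) : R :=
  Num.sqrt (\sum_(i < k) v ord0 i ^+ 2).

(* Euclidean diameter, with diam set0 = 0 and diam of an unbounded set = +oo *)
Definition ediam (k : nat) (A : set 'rV[R]_k) : \bar R :=
  ereal_sup ([set 0%E] `|` [set (enorm (x - y))%:E | x in A & y in A]).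

Definition gauge (phi : R -> R) : Prop :=
  [/\ {in `[0, +oo[ &, {homo phi : x y / x < y}},
      {within `[0, +oo[, continuous phi},
      phi 0 = 0 &
      forall r, 0 < r -> 0 < phi r].

Definition hausdorff_pre (phi : R -> R) (k : nat) (delta : R)
  (E : set 'rV[R]_k) : \bar R :=
  ereal_inf [set (\sum_(0 <= i <oo) (phi (fine (ediam (F i))))%:E)%E
            | F in [set F : nat -> set 'rV[R]_k |
                     (forall i, (ediam (F i) <= delta%:E)%E) /\
                     E `<=` \bigcup_i F i]].

(* H^phi = lim_{delta -> 0+} H^phi_delta = sup_{delta > 0} H^phi_delta
   (the map delta |-> H^phi_delta is nonincreasing) *)
Definition hausdorff (phi : R -> R) (k : nat) (E : set 'rV[R]_k) : \bar R :=
  ereal_sup [set hausdorff_pre phi delta E | delta in `]0, +oo[].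

Definition rcons0 (m : nat) (t : R) (v : 'rV[R]_m) : 'rV[R]_m.+1 :=
  \row_(i < m.+1) (if unlift ord0 i is Some j then v ord0 j else t).

(* Lebesgue integral over R^k of a nonnegative function, as an iterated
   integral (Tonelli) of one-dimensional Lebesgue integrals *)
Fixpoint iint (k : nat) : ('rV[R]_k -> \bar R) -> \bar R :=
  match k with
  | 0 => fun f => f 0
  | m.+1 => fun f =>
      (\int[@lebesgue_measure R]_t iint (fun v => f (rcons0 t v)))%E
  end.

Definition sint (k : nat) (f : 'rV[R]_k -> R) : \bar R :=
  (iint (fun x => (Num.max (f x) 0)%:E) - iint (fun x => (Num.max (- f x) 0)%:E))%E.

Definition borel_meas (k : nat) (f : 'rV[R]_k -> R) : Prop :=
  forall B : set R, open B ->
    smallest (sigma_algebra setT) (@open 'rV[R]_k) (f @^-1` B).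

Definition loc_int (k : nat) (f : 'rV[R]_k -> R) : Prop :=
  borel_meas f /\
  forall K : set 'rV[R]_k, compact K ->
    (iint (fun x => (`|f x| * \1_K x)%:E) < +oo)%E.

Definition evec (k : nat) (j : 'I_k) : 'rV[R]_k := delta_mx ord0 j.
Definition pderiv (k : nat) (j : 'I_k) (f : 'rV[R]_k -> R) : 'rV[R]_k -> R :=
  fun x => 'D_(evec j) f x.
Fixpoint pderivs (k : nat) (js : seq 'I_k) (f : 'rV[R]_k -> R) : 'rV[R]_k -> R :=
  match js with
  | [::] => f
  | j :: js' => pderiv j (pderivs js' f)
  end.

Definition test_fun (k : nat) (f : 'rV[R]_k -> R) : Prop :=
  (forall (js : seq 'I_k) (x : 'rV[R]_k), differentiable (pderivs js f) x) /\
  exists K : set 'rV[R]_k, compact K /\ forall x, ~ K x -> f x = 0.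

Definition weak_pderiv (k : nat) (j : 'I_k) (f g : 'rV[R]_k -> R) : Prop :=
  loc_int g /\
  forall psi, test_fun psi ->
    sint (fun x => (f x * pderiv j psi x)%R) = (- sint (fun x => (g x * psi x)%R))%E.

Definition V1p (k m : nat) (p : R) (u : 'rV[R]_k -> 'rV[R]_m) : Prop :=
  (forall i : 'I_m, loc_int (fun x => u x ord0 i)) /\
  exists g : 'I_m -> 'I_k -> 'rV[R]_k -> R,
    (forall i j, weak_pderiv j (fun x => u x ord0 i) (g i j)) /\
    (iint (fun x => ((Num.sqrt (\sum_(i < m) \sum_(j < k) g i j x ^+ 2)) `^ p)%:E)
       < +oo)%E.

End Defs.

(* Main.v *)
Require Import Defs.
From HB Require Import structures.
From mathcomp Require Import all_boot all_order all_algebra.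
From mathcomp Require Import all_classical all_reals all_analysis.
From mathcomp Require Import ring lra.
Import Order.TTheory GRing.Theory Num.Theory.
Import numFieldNormedType.Exports.
Local Open Scope classical_set_scope.
Local Open Scope ring_scope.
Set Implicit Arguments.
Unset Strict Implicit.
Unset Printing Implicit Defensive.

(** The domain carries the self-similar Cantor set E with 2^n pieces per
    generation, of side lam^k with lam^alpha = 2^-n.  The map u sends the 2^(nk)
    pieces of generation k to pieces of side s_k = mu^k (k+1)^-b, where
    mu^sigma = 2^-n and b = 1 + 1/sigma.  It is the sum over k of s_k times a
    tensor product of cut-offs, and the gradients of different generations have
    disjoint supports; since sigma is exactly the exponent with
    mu^p lam^(n-p) 2^n = 1, generation k contributes a multiple of
    (k+1)^(-bp) to the p-energy, which is summable because bp > 2.  The mass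
    2^-(nk) of a piece of u(E) is o(phi(s_k)) because gamma > b sigma = 1 + sigma,
    so the mass distribution principle makes the phi-measure of u(E) infinite. *)

(** Volume integrals are iterated one-dimensional integrals. Each generation of u is therefore a
    tensor product of uniformly continuous, compactly supported functions of one variable: on such
    functions the iterated integral is linear, translation invariant and computed factor by factor,
    and integration by parts reduces to translation invariance.

    The gradients are disjoint because of the profile of the cut-off. It equals 1 on |t| <= 1/2 +
    lam, which contains both children of [-1, 1], so a generation varies only in a margin that later
    generations never enter. The p-energies then add up, with no triangle inequality in L^p.

    Near the Cantor set the i-th component of generation k is +s_k or -s_k according to the k-th
    binary digit of coordinate i: u keeps the address of a point and only replaces the side lengths.
    The exponent b lies strictly between 1/p, which the energy requires, and gamma/sigma, which the
    measure of the image requires. *)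

Section Integral1.
Variable R : realType.
Local Notation lmu := (@lebesgue_measure R).

(** * One-dimensional integrals of continuous functions with compact support *)

Definition cc1 (M : R) (f : R -> R) :=
  continuous f /\ forall t, M < `|t| -> f t = 0.

Definition int1 (f : R -> R) : R := \int[lmu]_t f t.

Lemma cc1_restrict M f : cc1 M f -> f = f \_ `[-M, M].
Proof.
case=> _ f0; apply/funext => t; rewrite patchE; case: ifPn => //.
rewrite notin_setE /= in_itv /= -ler_norml => /negP; rewrite -ltNge; exact: f0.
Qed.

Lemma cc1_integrable M f : cc1 M f -> lmu.-integrable setT (EFin \o f).
Proof.
move=> ccf; have [cf _] := ccf; rewrite (cc1_restrict ccf).
have -> : EFin \o f \_ `[-M, M] = (EFin \o f) \_ `[-M, M].
  by apply/funext => t; rewrite /= !patchE; case: ifP.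
apply/(@integrable_mkcond _ _ R lmu `[-M, M]%classic (EFin \o f)) => //.
apply: continuous_compact_integrable; first exact: segment_compact.
exact: continuous_subspaceT.
Qed.

Lemma I1_EFin M f : cc1 M f -> (\int[lmu]_t (f t)%:E)%E = (int1 f)%:E.
Proof.
move=> ccf; rewrite /int1 /Rintegral fineK//.
exact: integrable_fin_num (cc1_integrable ccf).
Qed.

Lemma I1_itv M f : cc1 M f -> (\int[lmu]_(t in `[(- M)%R, M]) (f t)%:E)%E = (int1 f)%:E.
Proof.
move=> ccf; rewrite integral_mkcond -(I1_EFin ccf); apply: eq_integral => t _.
by rewrite [in RHS](cc1_restrict ccf) /= !patchE; case: ifP.
Qed.

Lemma I1D M f g : cc1 M f -> cc1 M g -> int1 (fun t => f t + g t) = int1 f + int1 g.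
Proof.
by move=> cf cg; rewrite /int1 RintegralD//; [exact: cc1_integrable cf|exact: cc1_integrable cg].
Qed.

Lemma I1Z M (a : R) f : cc1 M f -> int1 (fun t => a * f t) = a * int1 f.
Proof. by move=> cf; rewrite /int1 RintegralZl//; exact: cc1_integrable cf. Qed.

(** Valid for arbitrary integrands, since the integral of a nonnegative function is a supremum over
    the simple functions below it. [iint_le] relies on this: its inner integrals carry no
    measurability information. *)
Lemma ge0_mono_integral (f g : R -> \bar R) : (forall t, 0 <= f t)%E ->
  (forall t, f t <= g t)%E -> (\int[lmu]_t f t <= \int[lmu]_t g t)%E.
Proof.
move=> f0 fg; have g0 t : (0 <= g t)%E by exact: le_trans (fg t).
rewrite !ge0_integralTE//; apply: ub_ereal_sup => _ /= [h hf <-].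
by apply: ereal_sup_ubound; exists h => // t; apply: le_trans (hf t) (fg t).
Qed.

Lemma I1_bound M (B : R) f : 0 <= M -> cc1 M f -> (forall t, `|f t| <= B) ->
  `|int1 f| <= 2 * M * B.
Proof.
move=> M0 ccf fB; have [cf f0] := ccf.
have B0 : 0 <= B by apply: le_trans (fB 0).
have mM : measurable (`[-M, M]%classic : set (measurableTypeR R)) by exact: measurable_itv.
have iN : lmu.-integrable `[-M, M] (EFin \o f).
  by apply: integrableS (cc1_integrable ccf).
rewrite -lee_fin (_ : (`|int1 f|)%:E = `|(int1 f)%:E|%E)// -(I1_itv ccf).
apply: (le_trans (@le_abse_integral _ _ R lmu _ (EFin \o f) mM _)).
  by case/integrableP: iN.
apply: (@le_trans _ _ (\int[lmu]_(t in `[(- M)%R, M]) B%:E)%E).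
  rewrite integral_mkcond [leRHS]integral_mkcond.
  apply: ge0_mono_integral => t; rewrite !patchE; case: ifP => //= _.
  by rewrite lee_fin.
rewrite integral_cst//= lebesgue_measure_itv /= lte_fin.
case: ifPn => _; last by rewrite mule0 lee_fin !mulr_ge0.
by rewrite -EFinB -EFinM lee_fin; lra.
Qed.

(** Substitution over a segment: F maps [a - l M, a + l M] increasingly onto [-M, M], which carries
    f. The case l = 1 gives translation invariance, the case l = lam the scaling of the Cantor
    pieces. *)
Lemma I1_affine M (l a : R) f : 0 < l -> 0 <= M -> cc1 M f ->
  int1 (fun t => f (l^-1 * (t - a))) = l * int1 f.
Proof.
move=> l0 M0 ccf; have [cf f0] := ccf.
set F := fun t : R => l^-1 * (t - a).
have DF (x : R) : is_derive x 1 F l^-1.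
  by apply: is_derive_eq; rewrite /GRing.scale /=; lra.
have F' : derive1 F = cst l^-1.
  by apply/funext => x; rewrite derive1E derive_val.
have cF : continuous F.
  by move=> x; apply: differentiable_continuous; apply/derivable1_diffP.
pose N := `|a| + l * M.
have ccF : cc1 N (f \o F).
  split=> [x|t tN] /=; first by apply: continuous_comp; [exact: cF|exact: cf].
  apply: f0; rewrite /F normrM gtr0_norm ?invr_gt0// mulrC ltr_pdivlMr//.
  have := ler_normB t a; have := lerB_dist t a; rewrite /N in tN; lra.
have -> : (fun t => f (l^-1 * (t - a))) = f \o F by [].
have lM0 : 0 <= l * M by rewrite mulr_ge0// ltW.
have ccF2 : (\int[lmu]_(t in `[(a - l * M)%R, (a + l * M)%R]) ((f \o F) t)%:E = (int1 (f \o F))%:E)%E.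
  rewrite -(I1_EFin ccF) integral_mkcond; apply: eq_integral => t _.
  rewrite patchE; case: ifPn => //.
  rewrite notin_setE /= in_itv /= => /negP tN.
  rewrite f0//= /F normrM gtr0_norm ?invr_gt0// mulrC ltr_pdivlMr//.
  by rewrite ltNge mulrC ler_norml; apply: contra tN => /andP[]; lra.
have H := @integration_by_substitution_increasing R F f (a - l * M) (a + l * M).
have F1 : F (a - l * M) = - M by rewrite /F; field; lra.
have F2 : F (a + l * M) = M by rewrite /F; field; lra.
rewrite F1 F2 F' (I1_itv ccf) in H.
have {}H : ((int1 f)%:E = \int[lmu]_(x in `[(a - l * M)%R, (a + l * M)%R]) (((f \o F) * cst l^-1) x)%:E)%E.
  apply: H.
  - lra.
  - move=> x y _ _ xy; rewrite /F ltr_pM2l ?invr_gt0//; lra.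
  - by move=> x _; exact: cvg_cst.
  - exact: is_cvg_cst.
  - exact: is_cvg_cst.
  - split=> [x _||]; first exact: ex_derive.
    + by apply: cvg_at_right_filter; exact: cF.
    + by apply: cvg_at_left_filter; exact: cF.
  - exact: continuous_subspaceT.
suff H2 : int1 f = l^-1 * int1 (f \o F) by rewrite H2 mulrA divff ?mul1r// gt_eqF.
apply: EFin_inj; rewrite EFinM -ccF2 H -integralZl//.
  by apply: eq_integral => x _; rewrite -EFinM mulrC.
by apply: integrableS (cc1_integrable ccF).
Qed.

End Integral1.

(** * The iterated integral on uniformly continuous functions supported in a box *)

Section IteratedIntegral.
Variable R : realType.
Local Notation lmu := (@lebesgue_measure R).

Definition ucont (k : nat) (f : 'rV[R]_k -> R) := forall e : R, 0 < e ->
  exists2 d : R, 0 < d & forall x y : 'rV[R]_k, (forall i, `|x ord0 i - y ord0 i| < d) ->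
    `|f x - f y| <= e.

Definition buc (k : nat) (f : 'rV[R]_k -> R) :=
  (exists B, forall x, `|f x| <= B) /\ ucont f.

(** Uniform continuity passes to slices with the same modulus and makes partial integrals continuous
    again; this drives the inductions on the dimension. *)
Definition cc (k : nat) (M : R) (f : 'rV[R]_k -> R) :=
  [/\ 0 <= M, forall (x : 'rV[R]_k) i, M < `|x ord0 i| -> f x = 0 & buc f].

Lemma bu_bound k (f : 'rV[R]_k -> R) : buc f -> exists2 B, 0 < B & forall x, `|f x| <= B.
Proof.
move=> [[B fB] _]; exists (`|B| + 1); first by rewrite ltr_wpDl.
by move=> x; apply: le_trans (fB x) _; apply: le_trans (ler_norm _) _; rewrite lerDl.
Qed.

Lemma bu_cst k (c : R) : buc (fun _ : 'rV[R]_k => c).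
Proof.
split; first by exists `|c|.
by move=> e e0; exists 1 => // x y _; rewrite subrr normr0 ltW.
Qed.

Lemma bu_mul k (f g : 'rV[R]_k -> R) : buc f -> buc g -> buc (fun x => f x * g x).
Proof.
move=> bf bg; have [B B0 fB] := bu_bound bf; have [C C0 gC] := bu_bound bg.
split; first by exists (B * C) => x; rewrite normrM ler_pM.
move=> e e0.
have [d1 d10 H1] := bf.2 _ (divr_gt0 e0 (mulr_gt0 (ltr0n _ 2) C0)).
have [d2 d20 H2] := bg.2 _ (divr_gt0 e0 (mulr_gt0 (ltr0n _ 2) B0)).
exists (Num.min d1 d2); first by rewrite lt_min d10.
move=> x y xy.
have -> : f x * g x - f y * g y = (f x - f y) * g x + f y * (g x - g y) by ring.
apply: (le_trans (ler_normD _ _)); rewrite !normrM.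
have h1 : `|f x - f y| * `|g x| <= e / (2 * C) * C.
  apply: ler_pM => //; apply: H1 => i; have := xy i.
  by rewrite lt_min => /andP[].
have h2 : `|f y| * `|g x - g y| <= B * (e / (2 * B)).
  apply: ler_pM => //; apply: H2 => i; have := xy i.
  by rewrite lt_min => /andP[].
have E1 : e / (2 * C) * C = e / 2 by field; lra.
have E2 : B * (e / (2 * B)) = e / 2 by field; lra.
lra.
Qed.

Lemma bu_lin k (a : R) (f g : 'rV[R]_k -> R) : buc f -> buc g -> buc (fun x => a * f x + g x).
Proof.
move=> bf bg; have [[B fB] uf] := bu_mul (bu_cst k a) bf; have [[C gC] ug] := bg.
split.
  by exists (B + C) => x; apply: (le_trans (ler_normD _ _)); apply: lerD.
move=> e e0; have e2 : 0 < e / 2 by lra.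
have [d1 d10 H1] := uf _ e2; have [d2 d20 H2] := ug _ e2.
exists (Num.min d1 d2); first by rewrite lt_min d10.
move=> x y xy.
have -> : a * f x + g x - (a * f y + g y) = (a * f x - a * f y) + (g x - g y) by ring.
apply: (le_trans (ler_normD _ _)).
have h1 : `|a * f x - a * f y| <= e / 2.
  by apply: H1 => i; have := xy i; rewrite lt_min => /andP[].
have h2 : `|g x - g y| <= e / 2.
  by apply: H2 => i; have := xy i; rewrite lt_min => /andP[].
lra.
Qed.

Lemma bu_prod k (I : Type) (r : seq I) (f : I -> 'rV[R]_k -> R) :
  (forall i, buc (f i)) -> buc (fun x => \prod_(i <- r) f i x).
Proof.
move=> bf; elim: r => [|i r IH].
  by under eq_fun do rewrite big_nil; exact: bu_cst.
by under eq_fun do rewrite big_cons; exact: bu_mul.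
Qed.

Lemma cc_lin k M (a : R) (f g : 'rV[R]_k -> R) : cc M f -> cc M g ->
  cc M (fun x => a * f x + g x).
Proof.
move=> [M0 f0 bf] [_ g0 bg]; split=> //; last exact: bu_lin.
by move=> x i xi; rewrite (f0 x i)// (g0 x i)// mulr0 addr0.
Qed.

Lemma cc_mul k M (f g : 'rV[R]_k -> R) : cc M f -> buc g -> cc M (fun x => f x * g x).
Proof.
move=> [M0 f0 bf] bg; split=> //; last exact: bu_mul.
by move=> x i xi; rewrite (f0 x i)// mul0r.
Qed.

Lemma cc_scale k M (a : R) (f : 'rV[R]_k -> R) : cc M f -> cc M (fun x => a * f x).
Proof. by move=> cf; under eq_fun do rewrite mulrC; apply: cc_mul => //; exact: bu_cst. Qed.

Lemma cc_mono k M M' (f : 'rV[R]_k -> R) : M <= M' -> cc M f -> cc M' f.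
Proof.
move=> MM [M0 f0 bf]; split=> //; first exact: le_trans MM.
by move=> x i xi; apply: (f0 x i); apply: le_lt_trans xi.
Qed.

Lemma cc_lip k M (h : R -> R) (f : 'rV[R]_k -> R) : h 0 = 0 ->
  (forall a b, `|h a - h b| <= `|a - b|) -> cc M f -> cc M (fun x => h (f x)).
Proof.
move=> h0 hl [M0 f0 [[B fB] uf]]; split=> //; last split.
- by move=> x i xi; rewrite (f0 x i).
- by exists B => x; have := hl (f x) 0; rewrite h0 !subr0 => /le_trans; apply.
- move=> e e0; have [d d0 H] := uf e e0; exists d => // x y xy.
  exact: le_trans (hl _ _) (H _ _ xy).
Qed.

Lemma lip_max0 (a b : R) : `|Num.max a 0 - Num.max b 0| <= `|a - b|.
Proof.
wlog ab : a b / b <= a.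
  move=> H; have [|/ltW] := leP b a; first exact: H.
  by move=> /H; rewrite distrC (distrC b).
rewrite (ger0_norm (_ : 0 <= a - b)) ?subr_ge0//.
by rewrite ger0_norm; case: (leP a 0); case: (leP b 0); lra.
Qed.

Lemma cc_max0 k M (f : 'rV[R]_k -> R) : cc M f -> cc M (fun x => Num.max (f x) 0).
Proof. by apply: (@cc_lip k M (fun a => Num.max a 0)); [rewrite maxxx|exact: lip_max0]. Qed.

Lemma cc_abs k M (f : 'rV[R]_k -> R) : cc M f -> cc M (fun x => `|f x|).
Proof. by apply: cc_lip; [exact: normr0|exact: ler_dist_dist]. Qed.

Lemma rcons0_0 m (t : R) (v : 'rV[R]_m) : rcons0 t v ord0 ord0 = t.
Proof. by rewrite mxE unlift_none. Qed.

Lemma rcons0_S m (t : R) (v : 'rV[R]_m) j : rcons0 t v ord0 (lift ord0 j) = v ord0 j.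
Proof. by rewrite mxE liftK. Qed.

Definition rcons0E := (rcons0_0, rcons0_S).

Lemma cc_slice m M (t : R) (f : 'rV[R]_m.+1 -> R) : cc M f -> cc M (fun v => f (rcons0 t v)).
Proof.
move=> [M0 f0 [[B fB] uf]]; split=> //; last split.
- by move=> v i vi; apply: (f0 _ (lift ord0 i)); rewrite rcons0E.
- by exists B.
- move=> e /uf[d d0 H]; exists d => // x y xy; apply: H => i.
  by case: (unliftP ord0 i) => [j|] ->; rewrite !rcons0E// subrr normr0.
Qed.

(** Real-valued twin of [iint], equal to it on [cc] functions by [iint_Jint], so that linearity can
    be used without extended reals. *)
Fixpoint Jint (k : nat) : ('rV[R]_k -> R) -> R :=
  match k with
  | 0 => fun f => f 0
  | m.+1 => fun f => int1 (fun t => Jint (fun v => f (rcons0 t v)))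
  end.

(** Proved together because each part feeds the others: linearity and the bound, applied to the
    difference of two slices, make the slice integral continuous in t, and this continuity gives
    linearity and the bound one dimension higher. *)
Lemma Jint_lin_bound_slice k :
  (forall M (a : R) (f g : 'rV[R]_k -> R), cc M f -> cc M g ->
    Jint (fun x => a * f x + g x) = a * Jint f + Jint g) /\
  (forall M (B : R) (f : 'rV[R]_k -> R), cc M f -> (forall x, `|f x| <= B) ->
    `|Jint f| <= (2 * M) ^+ k * B) /\
  (forall M (f : 'rV[R]_k.+1 -> R), cc M f -> cc1 M (fun t => Jint (fun v => f (rcons0 t v)))).
Proof.
elim: k => [|k [IHl [IHb IHc]]].
  split; first by [].
  split; first by move=> M B f _ fB; rewrite expr0 mul1r; exact: fB.
  move=> M f [M0 f0 [_ uf]]; split; last first.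
    by move=> t tM /=; apply: (f0 _ ord0); rewrite rcons0E.
  move=> t /=; apply/cvgrPdist_le => e e0.
  have [d d0 H] := uf e e0.
  near=> y; apply: H => i.
  case: (unliftP ord0 i) => [j|] ->; first by case: j.
  rewrite !rcons0E.
  by near: y; exact: cvgr_dist_lt.
have lin : forall M (a : R) (f g : 'rV[R]_k.+1 -> R), cc M f -> cc M g ->
    Jint (fun x => a * f x + g x) = a * Jint f + Jint g.
  move=> M a f g cf cg /=.
  transitivity (int1 (fun t => a * Jint (fun v => f (rcons0 t v)) + Jint (fun v => g (rcons0 t v)))).
    congr int1; apply/funext => t; apply: (IHl M); exact: cc_slice.
  have cf' : cc1 M (fun t => a * Jint (fun v => f (rcons0 t v))).
    have [h1 h2] := IHc _ _ cf; split=> [x|t tM].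
      by apply: cvgM; [exact: cvg_cst|exact: h1].
    by rewrite h2// mulr0.
  by rewrite (I1D cf' (IHc _ _ cg)) (I1Z _ (IHc _ _ cf)).
have bnd : forall M (B : R) (f : 'rV[R]_k.+1 -> R), cc M f -> (forall x, `|f x| <= B) ->
    `|Jint f| <= (2 * M) ^+ k.+1 * B.
  move=> M B f cf fB /=; rewrite exprS -mulrA.
  have [M0 _ _] := cf; apply: I1_bound => //; first exact: IHc.
  by move=> t; apply: IHb => //; exact: cc_slice.
split=> //; split=> // M f cf; have [M0 f0 [_ uf]] := cf; split; last first.
  move=> t tM; rewrite (_ : (fun v => _) = fun=> 0).
    have c0 : cc M (fun _ : 'rV[R]_k.+1 => 0 : R) by split=> //; exact: bu_cst.
    have : `|Jint (fun _ : 'rV[R]_k.+1 => 0 : R)| <= (2 * M) ^+ k.+1 * 0.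
      by apply: bnd c0 _ => x; rewrite normr0.
    by rewrite mulr0 normr_le0 => /eqP.
  by apply/funext => v; apply: (f0 _ ord0); rewrite rcons0E.
move=> t; apply/cvgrPdist_le => e e0.
have K0 : 0 < (2 * M) ^+ k.+1 + 1 by rewrite ltr_wpDl// exprn_ge0// mulr_ge0.
have [d d0 H] := uf _ (divr_gt0 e0 K0).
near=> y.
have -> : Jint (fun v => f (rcons0 t v)) - Jint (fun v => f (rcons0 y v)) =
   Jint (fun v => (-1) * f (rcons0 y v) + f (rcons0 t v)).
  by rewrite (lin M) ?mulN1r 1?addrC//; exact: cc_slice.
apply: (@le_trans _ _ ((2 * M) ^+ k.+1 * (e / ((2 * M) ^+ k.+1 + 1)))).
  apply: bnd; first by apply: cc_lin; exact: cc_slice.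
  move=> v; rewrite mulN1r addrC; apply: H => i.
  case: (unliftP ord0 i) => [j|] ->; rewrite !rcons0E; first by rewrite subrr normr0.
  by near: y; exact: cvgr_dist_lt.
rewrite mulrA ler_pdivrMr// mulrC; apply: ler_wpM2l; [exact: ltW|lra].
Unshelve. all: by end_near. Qed.

Lemma Jint_lin k M (a : R) (f g : 'rV[R]_k -> R) : cc M f -> cc M g ->
  Jint (fun x => a * f x + g x) = a * Jint f + Jint g.
Proof. by have [H _] := Jint_lin_bound_slice k; exact: H. Qed.

Lemma Jint_bound k M (B : R) (f : 'rV[R]_k -> R) : cc M f -> (forall x, `|f x| <= B) ->
  `|Jint f| <= (2 * M) ^+ k * B.
Proof. by have [_ [H _]] := Jint_lin_bound_slice k; exact: H. Qed.

Lemma Jint_slice k M (f : 'rV[R]_k.+1 -> R) : cc M f ->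
  cc1 M (fun t => Jint (fun v => f (rcons0 t v))).
Proof. by have [_ [_ H]] := Jint_lin_bound_slice k; exact: H. Qed.

Lemma JintZ k M (a : R) (f : 'rV[R]_k -> R) : cc M f -> Jint (fun x => a * f x) = a * Jint f.
Proof.
move=> cf; have c0 : cc M (fun _ : 'rV[R]_k => 0 : R).
  by case: cf => ? ? ?; split=> //; exact: bu_cst.
have := Jint_lin a cf c0; under eq_fun do rewrite addr0; move=> ->.
(* Linearity applied to 0 = 1 * 0 + 0 gives z = z + z for the integral z of 0. *)
have := Jint_lin 1 c0 c0; under eq_fun do rewrite mulr0 addr0; rewrite mul1r.
set z := Jint _ => h; have -> : z = 0 by lra.
by rewrite addr0.
Qed.

Lemma iint_Jint k M (f : 'rV[R]_k -> R) : cc M f ->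
  iint (fun x => (f x)%:E) = (Jint f)%:E.
Proof.
elim: k f => [//|k IH] f cf /=.
under eq_integral do rewrite (IH _ (cc_slice _ cf)).
by rewrite (I1_EFin (Jint_slice cf)).
Qed.

Lemma sint_Jint k M (f : 'rV[R]_k -> R) : cc M f -> sint f = (Jint f)%:E.
Proof.
move=> cf; rewrite /sint (iint_Jint (cc_max0 cf)).
have cN : cc M (fun x => - f x).
  by under eq_fun do rewrite -mulN1r; exact: cc_scale.
rewrite (iint_Jint (cc_max0 cN)) -EFinB; congr EFin.
rewrite addrC -mulN1r -(Jint_lin _ (cc_max0 cN) (cc_max0 cf)).
congr Jint; apply/funext => x; case: (leP (f x) 0); case: (leP (- f x) 0); lra.
Qed.

Lemma iint_ge0 k (f : 'rV[R]_k -> \bar R) : (forall x, 0 <= f x)%E -> (0 <= iint f)%E.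
Proof.
elim: k f => [|k IH] f f0 /=; first exact: f0.
by apply: integral_ge0 => t _; apply: IH.
Qed.

Lemma iint_le k (f g : 'rV[R]_k -> \bar R) : (forall x, 0 <= f x)%E ->
  (forall x, f x <= g x)%E -> (iint f <= iint g)%E.
Proof.
elim: k f g => [|k IH] f g f0 fg /=; first exact: fg.
by apply: ge0_mono_integral => t; [exact: iint_ge0|exact: IH].
Qed.

(** Monotone convergence, one variable at a time; the measurability that it asks of each partial
    integral comes from [Jint_slice]. *)
Lemma iint_series k M (f : nat -> 'rV[R]_k -> R) : (forall m, cc M (f m)) ->
  (forall m x, 0 <= f m x) ->
  (iint (fun x => \sum_(0 <= m <oo) (f m x)%:E) = \sum_(0 <= m <oo) (Jint (f m))%:E)%E.
Proof.
elim: k f => [//|k IH] f cf f0 /=.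
transitivity (\int[lmu]_t \sum_(0 <= m <oo) (Jint (fun v => f m (rcons0 t v)))%:E)%E.
  by apply: eq_integral => t _; apply: IH => [m|m x]; [exact: cc_slice|exact: f0].
rewrite integral_nneseries//; last 2 first.
- by move=> m; have /integrableP[] := cc1_integrable (Jint_slice (cf m)).
- move=> m t _; rewrite -(iint_Jint (cc_slice t (cf m))); apply: iint_ge0 => x.
  by rewrite lee_fin.
by apply: eq_eseriesr => m _; rewrite (I1_EFin (Jint_slice (cf m))).
Qed.

Lemma Jint_ge0 k M (f : 'rV[R]_k -> R) : cc M f -> (forall x, 0 <= f x) -> 0 <= Jint f.
Proof.
by move=> cf f0; rewrite -lee_fin -(iint_Jint cf); apply: iint_ge0 => x; rewrite lee_fin.
Qed.

Lemma rcons0_addS m (t a : R) (v : 'rV[R]_m) j :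
  rcons0 t v + a *: evec R (lift ord0 j) = rcons0 t (v + a *: evec R j).
Proof.
apply/rowP => i; rewrite 2!mxE.
case: (unliftP ord0 i) => [l|] ->; rewrite !rcons0E !mxE ?eqxx/=.
  by rewrite (inj_eq (@lift_inj _ ord0)).
by rewrite mulr0 addr0.
Qed.

Lemma rcons0_add0 m (t a : R) (v : 'rV[R]_m) :
  rcons0 t v + a *: evec R ord0 = rcons0 (t + a) v.
Proof.
apply/rowP => i; rewrite 2!mxE.
case: (unliftP ord0 i) => [l|] ->; rewrite !rcons0E !mxE ?eqxx/= ?mulr1//.
by rewrite mulr0 addr0.
Qed.

Lemma cc_translate k M (a : R) (j : 'I_k) (f : 'rV[R]_k -> R) : cc M f ->
  cc (M + `|a|) (fun x => f (x + a *: evec R j)).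
Proof.
move=> [M0 f0 [[B fB] uf]]; split; first by rewrite addr_ge0.
- move=> x i xi; apply: (f0 _ i); rewrite !mxE eqxx /=.
  have b1 : `|a * (i == j)%:R| <= `|a|.
    by case: (i == j); rewrite ?mulr1// mulr0 normr0.
  have := lerB_normD (x ord0 i) (a * (i == j)%:R); lra.
- split; first by exists B.
  move=> e /uf[d d0 H]; exists d => // x y xy; apply: H => i.
  by rewrite !mxE opprD addrACA subrr addr0.
Qed.

Lemma Jint_translate k M (a : R) (j : 'I_k) (f : 'rV[R]_k -> R) : cc M f ->
  Jint (fun x => f (x + a *: evec R j)) = Jint f.
Proof.
elim: k j f => [[]//|k IH] j f cf /=.
case: (unliftP ord0 j) => [l|] ->.
  congr int1; apply/funext => t; rewrite -(IH l _ (cc_slice t cf)).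
  by congr Jint; apply/funext => v; rewrite rcons0_addS.
under eq_fun do under eq_fun do rewrite rcons0_add0.
have [M0 _ _] := cf.
have := I1_affine (- a) ltr01 M0 (Jint_slice cf); rewrite mul1r => <-.
by congr int1; apply/funext => t; rewrite invr1 mul1r opprK.
Qed.

(* The remainder is uniform in x, so that difference quotients pass to the
   limit under Jint and translation invariance alone gives [Jint_udiff]. *)
Definition udiff k (j : 'I_k) (h h' : 'rV[R]_k -> R) := forall e : R, 0 < e ->
  exists2 d : R, 0 < d & forall (x : 'rV[R]_k) (a : R), `|a| < d ->
    `|h (x + a *: evec R j) - h x - a * h' x| <= e * `|a|.

Lemma Jint_udiff k M (j : 'I_k) (h h' : 'rV[R]_k -> R) : cc M h -> cc M h' ->
  udiff j h h' -> Jint h' = 0.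
Proof.
move=> ch ch' hd; have [M0 _ _] := ch.
apply/eqP; rewrite -normr_le0; apply/ler_addgt0Pl => e e0; rewrite addr0.
pose K := (2 * (M + 1)) ^+ k.
have K0 : 0 <= K by rewrite exprn_ge0//; lra.
have [d d0 H] := hd _ (divr_gt0 e0 (ltr_wpDl K0 ltr01)).
(* A single step a suffices: translation invariance removes the difference quotient and leaves |a|
   |Jint h'| <= K e / (K + 1) |a|. The cap at 1 keeps the translate inside the box of radius M +
   1. *)
pose a := Num.min (d / 2) 1.
have a0 : 0 < a by rewrite lt_min ltr01 andbT; lra.
have ad : `|a| < d by rewrite gtr0_norm// gt_min; apply/orP; left; lra.
have a1 : `|a| <= 1 by rewrite gtr0_norm// ge_min lexx orbT.
have MM : M <= M + 1 by lra.
have cT : cc (M + 1) (fun x => h (x + a *: evec R j)).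
  by apply: cc_mono (cc_translate a j ch); lra.
have cB : cc (M + 1) (fun x => (-1) * h x + h (x + a *: evec R j)).
  by apply: cc_lin => //; exact: cc_mono ch.
have cF : cc (M + 1) (fun x => (- a) * h' x + ((-1) * h x + h (x + a *: evec R j))).
  by apply: cc_lin => //; exact: cc_mono ch'.
have := Jint_bound cF (B := (e / (K + 1)) * `|a|).
rewrite (Jint_lin _ (cc_mono MM ch') cB) (Jint_lin _ (cc_mono MM ch) cT).
rewrite (Jint_translate _ _ ch) mulN1r addNr addr0 normrM normrN => HH.
have {}HH : `|a| * `|Jint h'| <= K * (e / (K + 1) * `|a|).
  apply: HH => x; apply: le_trans (H x a ad).
  by rewrite le_eqVlt; apply/orP; left; apply/eqP; congr (`| _ |); ring.
have a0' : 0 < `|a| by rewrite normr_gt0 gt_eqF.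
rewrite -(ler_pM2l a0'); apply: (le_trans HH).
have -> : K * (e / (K + 1) * `|a|) = `|a| * (K / (K + 1) * e) by field; lra.
rewrite ler_pM2l// -[leRHS]mul1r ler_pM2r// ler_pdivrMr; lra.
Qed.

Definition uc1 (f : R -> R) := forall e : R, 0 < e ->
  exists2 d : R, 0 < d & forall s t : R, `|s - t| < d -> `|f s - f t| <= e.

Definition cu1 (M : R) (f : R -> R) :=
  [/\ 0 <= M, forall t, M < `|t| -> f t = 0, exists B, forall t, `|f t| <= B & uc1 f].

Lemma cu1_cc1 M f : cu1 M f -> cc1 M f.
Proof.
move=> [_ f0 _ uf]; split=> // t; apply/cvgrPdist_le => e e0.
have [d d0 H] := uf e e0.
by near=> y; apply: H; near: y; exact: cvgr_dist_lt.
Unshelve. all: by end_near. Qed.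

Lemma cc_prod k M (f : 'I_k -> R -> R) : 0 <= M -> (forall i, cu1 M (f i)) ->
  cc M (fun x : 'rV[R]_k => \prod_i f i (x ord0 i)).
Proof.
move=> M0 cf; split=> //.
- move=> x i xi; apply/eqP; rewrite prodf_seq_eq0; apply/hasP; exists i.
    by rewrite mem_index_enum.
  by have [_ f0 _ _] := cf i; rewrite /= f0.
- apply: (@bu_prod k _ _ (fun i (x : 'rV[R]_k) => f i (x ord0 i))) => i.
  have [_ _ [B fB] uf] := cf i; split; first by exists B.
  by move=> e /uf[d d0 H]; exists d => // x y xy; apply: H.
Qed.

Lemma Jint_prod k M (f : 'I_k -> R -> R) : 0 <= M -> (forall i, cu1 M (f i)) ->
  Jint (fun x => \prod_i f i (x ord0 i)) = \prod_i int1 (f i).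
Proof.
move=> M0; elim: k f => [|k IH] f cf /=; first by rewrite !big_ord0.
have E t : (fun v : 'rV[R]_k => \prod_i f i (rcons0 t v ord0 i)) =
    fun v => f ord0 t * \prod_i f (lift ord0 i) (v ord0 i).
  apply/funext => v; rewrite big_ord_recl rcons0_0; congr (_ * _).
  by apply: eq_bigr => i _; rewrite rcons0_S.
have cP := cc_prod M0 (fun i => cf (lift ord0 i)).
rewrite big_ord_recl -(IH (fun i => f (lift ord0 i)))//.
rewrite mulrC -(I1Z _ (cu1_cc1 (cf ord0))); congr int1; apply/funext => t.
by rewrite E (JintZ _ cP) mulrC.
Qed.

End IteratedIntegral.

(** * The one-dimensional Cantor construction and its transfer operator *)

Section Levels.
Variables (R : realType) (lam : R).
Hypotheses (lam0 : 0 < lam) (lam2 : lam < 2^-1).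

Definition sgn (b : bool) : R := if b then 1 else -1.

(* The two similarities t |-> +-1/2 + lam t generate the Cantor set; [zo b] are
   their inverses, and [W k] is the set of points surviving [k] generations. *)
Definition zo (b : bool) (t : R) : R := lam^-1 * (t - sgn b / 2).

(** Pastes a shrunken copy of f onto each of the two children of [-1, 1], with weight s on the left
    one. *)
Definition transfer (s : R) (f : R -> R) (t : R) : R := f (zo true t) + s * f (zo false t).

Fixpoint W (k : nat) (t : R) : Prop :=
  match k with
  | 0 => `|t| <= 1
  | m.+1 => W m (zo true t) \/ W m (zo false t)
  end.

Lemma zoK b t : t = sgn b / 2 + lam * zo b t.
Proof. by rewrite /zo mulrA divff ?gt_eqF// mul1r; ring. Qed.

Lemma zo_half b t : `|zo b t| <= 1 -> `|t| <= 2^-1 + lam.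
Proof.
rewrite {2}(zoK b t) !ler_norml => /andP[h1 h2].
have := ler_wpM2l (ltW lam0) h1; have := ler_wpM2l (ltW lam0) h2.
by case: b h1 h2 => /= _ _; rewrite /sgn => ? ?; apply/andP; split; lra.
Qed.

Lemma W_half k t : W k.+1 t -> `|t| <= 2^-1 + lam.
Proof.
elim: k t => [|k IH] t /=; first by case=> /zo_half.
have l2 := lam2; by case=> /IH h; [apply: (@zo_half true)|apply: (@zo_half false)]; lra.
Qed.

Lemma W_0 k t : W k t -> `|t| <= 1.
Proof. have l2 := lam2; by case: k => [//|k] /W_half; lra. Qed.

Lemma W_S k t : W k.+1 t -> W k t.
Proof.
elim: k t => [|k IH] t; first exact: W_0.
by case=> /IH h; [left|right].
Qed.

Lemma W_le j k t : (j <= k)%N -> W k t -> W j t.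
Proof.
move=> /subnK <-; elim: (k - j)%N => [//|m IH]; rewrite addSn => /W_S; exact: IH.
Qed.

(** The two inverse images differ by lam^-1 > 2, so they cannot both lie in [-1, 1]. Hence at most
    one term of [transfer] is nonzero. *)
Lemma zo_excl b t : `|zo b t| <= 1 -> 1 < `|zo (~~ b) t|.
Proof.
have i2 : 2 < lam^-1 by rewrite -[ltLHS]invrK ltf_pV2// posrE invr_gt0.
have -> : zo (~~ b) t = zo b t + sgn b * lam^-1.
  by rewrite /zo /sgn; case: b => /=; lra.
have := lerB_normD (sgn b * lam^-1) (zo b t).
rewrite (addrC (sgn b * _)) normrM (gtr0_norm (_ : 0 < lam^-1)) ?invr_gt0//.
have -> : `|sgn b| = 1 by case: b; rewrite /sgn ?normrN normr1.
lra.
Qed.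

Definition supp (k : nat) (f : R -> R) := forall t, ~ W k t -> f t = 0.

Lemma supp0 f : supp 0 f -> forall t, 1 < `|t| -> f t = 0.
Proof. by move=> sf t t1; apply: sf => /=; apply/negP; rewrite -ltNge. Qed.

Lemma cu1_supp0 f : cu1 1 f -> supp 0 f.
Proof. by case=> _ f0 _ _ t /negP; rewrite -ltNge; exact: f0. Qed.

Lemma supp_le j k f : (j <= k)%N -> supp k f -> supp j f.
Proof. by move=> jk sf t nW; apply: sf => /(W_le jk). Qed.

Lemma Tr_on s f t b : supp 0 f -> `|zo b t| <= 1 ->
  transfer s f t = (if b then 1 else s) * f (zo b t).
Proof.
move=> sf Wt; rewrite /transfer; have /(supp0 sf) := zo_excl Wt.
by case: b Wt => /= _ ->; rewrite ?mulr0 ?addr0 ?mul1r// add0r.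
Qed.

Lemma Tr_supp s k f : supp k f -> supp k.+1 (transfer s f).
Proof.
move=> sf t nW; rewrite /transfer !sf ?mulr0 ?addr0//; move=> h; apply: nW; by [left|right].
Qed.

Lemma iter_Tr_supp s j k f : supp k f -> supp (j + k) (iter j (transfer s) f).
Proof. by move=> sf; elim: j => [//|j IH]; rewrite addSn; apply: Tr_supp. Qed.

Lemma W_case k t : W k.+1 t -> exists b, W k (zo b t).
Proof. by case=> h; [exists true|exists false]. Qed.

Lemma Tr_vanish s k f : supp 0 f -> (forall t, W k t -> f t = 0) ->
  forall t, W k.+1 t -> transfer s f t = 0.
Proof.
move=> sf f0 t /W_case[b Wt].
by rewrite (Tr_on _ sf (W_0 Wt)) (f0 _ Wt) mulr0.
Qed.

Lemma Tr1_one k f : supp 0 f -> (forall t, W k t -> f t = 1) ->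
  forall t, W k.+1 t -> transfer 1 f t = 1.
Proof.
move=> sf f1 t /W_case[b Wt].
by rewrite (Tr_on _ sf (W_0 Wt)) (f1 _ Wt) if_same mulr1.
Qed.

(** The bound is not doubled, because only one of the two copies is nonzero at t. *)
Lemma Tr_bound s f B : supp 0 f -> `|s| <= 1 -> (forall t, `|f t| <= B) ->
  forall t, `|transfer s f t| <= B.
Proof.
move=> sf s1 fB t; have B0 : 0 <= B by apply: le_trans (fB 0).
case: (pselect (W 1 t)) => [/W_case[b Wt]|]; last first.
  by move=> /(Tr_supp s sf) ->; rewrite normr0.
rewrite (Tr_on _ sf (W_0 Wt)) normrM -[leRHS]mul1r ler_pM//.
by case: b Wt; rewrite ?normr1.
Qed.

Lemma Tr_scale s c f : transfer s (fun t => c * f t) = fun t => c * transfer s f t.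
Proof. by apply/funext => t; rewrite /transfer; ring. Qed.

Definition ud1 (f f' : R -> R) := forall e : R, 0 < e ->
  exists2 d : R, 0 < d & forall t a : R, `|a| < d ->
    `|f (t + a) - f t - a * f' t| <= e * `|a|.

Lemma zoD b t a : zo b (t + a) = zo b t + lam^-1 * a.
Proof. by rewrite /zo; ring. Qed.

Lemma Tr_cu1 s f : cu1 1 f -> cu1 1 (transfer s f).
Proof.
move=> cf; have sf := cu1_supp0 cf; have [_ _ [B fB] uf] := cf; split=> //.
- by apply: supp0; apply: (@supp_le 0 1) => //; exact: Tr_supp.
- exists (B + `|s| * B) => t; apply: (le_trans (ler_normD _ _)).
  by apply: lerD => //; rewrite normrM ler_wpM2l.
- move=> e e0; have k0 : 0 < 1 + `|s| by rewrite ltr_wpDr.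
  have [d d0 H] := uf _ (divr_gt0 e0 k0).
  exists (lam * d); first exact: mulr_gt0.
  move=> x y xy; rewrite /transfer.
  have h b : `|f (zo b x) - f (zo b y)| <= e / (1 + `|s|).
    apply: H; have -> : zo b x - zo b y = lam^-1 * (x - y) by rewrite /zo; ring.
    by rewrite normrM gtr0_norm ?invr_gt0// mulrC ltr_pdivrMr// mulrC.
  have -> : f (zo true x) + s * f (zo false x) - (f (zo true y) + s * f (zo false y)) =
     (f (zo true x) - f (zo true y)) + s * (f (zo false x) - f (zo false y)) by ring.
  apply: (le_trans (ler_normD _ _)); rewrite normrM.
  have -> : e = e / (1 + `|s|) + `|s| * (e / (1 + `|s|)) by field; lra.
  by apply: lerD => //; apply: ler_wpM2l.
Qed.

Lemma Tr_ud1 s f f' : ud1 f f' -> ud1 (transfer s f) (fun t => lam^-1 * transfer s f' t).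
Proof.
move=> uf e e0; have k0 : 0 < 1 + `|s| by rewrite ltr_wpDr.
have [d d0 H] := uf _ (divr_gt0 (mulr_gt0 lam0 e0) k0).
exists (lam * d); first exact: mulr_gt0.
move=> t a ad; rewrite /transfer !zoD.
have la : `|lam^-1 * a| = lam^-1 * `|a| by rewrite normrM gtr0_norm ?invr_gt0.
have h b := H (zo b t) (lam^-1 * a).
rewrite la in h.
have ad' : lam^-1 * `|a| < d by rewrite mulrC ltr_pdivrMr// mulrC.
pose X b := f (zo b t + lam^-1 * a) - f (zo b t) - lam^-1 * a * f' (zo b t).
rewrite (_ : _ - _ = X true + s * X false); last by rewrite /X; ring.
have l0 := lam0; apply: (le_trans (ler_normD _ _)); rewrite normrM.
have -> : e * `|a| = lam * e / (1 + `|s|) * (lam^-1 * `|a|)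
    + `|s| * (lam * e / (1 + `|s|) * (lam^-1 * `|a|)) by field; lra.
by apply: lerD; [exact: h|apply: ler_wpM2l => //; exact: h].
Qed.

Lemma iter_Tr_cu1 s k f : cu1 1 f -> cu1 1 (iter k (transfer s) f).
Proof. by move=> cf; elim: k => [//|k IH]; exact: Tr_cu1. Qed.

Lemma iter_Tr_ud1 s k f f' : ud1 f f' ->
  ud1 (iter k (transfer s) f) (fun t => lam ^- k * iter k (transfer s) f' t).
Proof.
move=> uf; elim: k => [|k IH] /=.
  by rewrite expr0 invr1; under eq_fun do rewrite mul1r.
have := Tr_ud1 s IH; rewrite Tr_scale.
by under eq_fun do rewrite mulrA -invfM -exprS.
Qed.

Lemma I1_Tr M f : cc1 M f -> 0 <= M -> int1 (transfer 1 f) = 2 * lam * int1 f.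
Proof.
move=> cf M0.
(* The copy around sgn b / 2 reaches at most 1/2 + lam M from the origin, which is below 1 + M. *)
have cz b : cc1 (1 + M) (fun t => f (zo b t)).
  have [cf1 f0] := cf; split=> [x|t tM].
    apply: (@continuous_comp _ _ _ (zo b) f); last exact: cf1.
    rewrite /zo; apply: cvgM; first exact: cvg_cst.
    by apply: cvgB; [exact: cvg_id|exact: cvg_cst].
  apply: f0; rewrite ltNge; apply/negP => h.
  have /eqP := zoK b t; apply/negP.
  suff : `|t| != `|sgn b / 2 + lam * zo b t|.
    by apply: contra_neq => {1}->.
  rewrite gt_eqF//; apply: le_lt_trans tM.
  apply: (le_trans (ler_normD _ _)); apply: lerD.
    by case: (b); rewrite /sgn ?mulN1r ?normrN ?mul1r ger0_norm//; lra.
  have l0 := lam0; have l2 := lam2; rewrite normrM gtr0_norm//.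
  apply: (@le_trans _ _ (1 * M)); last by rewrite mul1r.
  by apply: ler_pM => //; lra.
rewrite /transfer; under eq_fun do rewrite mul1r.
rewrite (I1D (cz true) (cz false)) /zo.
by rewrite !(I1_affine _ lam0 M0 cf); ring.
Qed.

Lemma I1_iter_Tr k f : cu1 1 f -> int1 (iter k (transfer 1) f) = (2 * lam) ^+ k * int1 f.
Proof.
move=> cf; elim: k => [|k IH]; first by rewrite expr0 mul1r.
by rewrite iterS (@I1_Tr 1)// ?IH ?exprS ?mulrA//; apply: cu1_cc1; exact: iter_Tr_cu1.
Qed.

(** The weight s enters in the innermost step only: each interval of generation k receives the same
    pattern, f on its right child and s f on its left child. *)
Definition gen (k : nat) (s : R) (f : R -> R) := iter k (transfer 1) (transfer s f).

Lemma Q_supp k s f : supp 0 f -> supp k.+1 (gen k s f).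
Proof. by move=> sf; rewrite -addn1; apply: iter_Tr_supp; exact: Tr_supp. Qed.

Lemma iter_Tr_vanish j k f : supp 0 f -> (forall t, W k t -> f t = 0) ->
  forall t, W (j + k) t -> iter j (transfer 1) f t = 0.
Proof.
move=> sf f0; elim: j => [//|j IH]; rewrite addSn; apply: Tr_vanish => //.
by apply: (@supp_le 0 (j + 0)) => //; exact: iter_Tr_supp.
Qed.

Lemma iter_Tr_one j k f : supp 0 f -> (forall t, W k t -> f t = 1) ->
  forall t, W (j + k) t -> iter j (transfer 1) f t = 1.
Proof.
move=> sf f0; elim: j => [//|j IH]; rewrite addSn; apply: Tr1_one => //.
by apply: (@supp_le 0 (j + 0)) => //; exact: iter_Tr_supp.
Qed.

(** Together with [Q_supp] this confines the function to [W k.+1] minus [W k.+2]. Applied to the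
    derivative of the cut-off, it separates the generations of the gradient. *)
Lemma Q_vanish k s f : supp 0 f -> (forall t, W 1 t -> f t = 0) ->
  forall t, W k.+2 t -> gen k s f t = 0.
Proof.
move=> sf f0; rewrite -addn2; apply: iter_Tr_vanish; last exact: Tr_vanish.
by apply: (@supp_le 0 1) => //; exact: Tr_supp.
Qed.

Lemma Q_bound k s f B : supp 0 f -> `|s| <= 1 -> (forall t, `|f t| <= B) ->
  forall t, `|gen k s f t| <= B.
Proof.
move=> sf s1 fB; have sT : supp 0 (transfer s f).
  by apply: (@supp_le 0 1) => //; exact: Tr_supp.
elim: k => [|k IH]; first exact: Tr_bound.
apply: Tr_bound; rewrite ?normr1//.
by apply: (@supp_le 0 (k + 0)) => //; exact: iter_Tr_supp.
Qed.

Lemma Q_cu1 k s f : cu1 1 f -> cu1 1 (gen k s f).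
Proof. by move=> cf; apply: iter_Tr_cu1; exact: Tr_cu1. Qed.

Lemma iter_Tr_scale k s c f :
  iter k (transfer s) (fun t => c * f t) = fun t => c * iter k (transfer s) f t.
Proof. by elim: k => [//|k IH] /=; rewrite IH Tr_scale. Qed.

Lemma Q_ud1 k s f f' : ud1 f f' -> ud1 (gen k s f) (fun t => lam ^- k.+1 * gen k s f' t).
Proof.
move=> uf; have := iter_Tr_ud1 1 k (Tr_ud1 s uf); rewrite iter_Tr_scale.
by under eq_fun do rewrite mulrA -invfM -exprSr.
Qed.

(* [x] is the orbit of [x 0] under the expanding maps selected by the digits [e]. *)
Lemma iter_Tr_orbit (e : nat -> bool) (x : nat -> R) k f : supp 0 f ->
  (forall j, `|x j| <= 1) -> (forall j, zo (e j) (x j) = x j.+1) ->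
  iter k (transfer 1) f (x 0%N) = f (x k).
Proof.
elim: k e x => [//|k IH] e x sf x1 xe.
rewrite iterS (@Tr_on _ _ _ (e 0%N)) ?xe//; last first.
  by apply: (@supp_le 0 (k + 0)) => //; exact: iter_Tr_supp.
by rewrite if_same mul1r (IH (fun j => e j.+1) (fun j => x j.+1)).
Qed.

Lemma orbit_W (e : nat -> bool) (x : nat -> R) k :
  (forall j, `|x j| <= 1) -> (forall j, zo (e j) (x j) = x j.+1) -> W k (x 0%N).
Proof.
elim: k e x => [//|k IH] e x x1 xe; first exact: x1.
have : W k (x 1%N) by apply: (IH (fun j => e j.+1) (fun j => x j.+1)).
by rewrite -xe /=; case: (e 0%N) => h; [left|right].
Qed.

(** The k unsigned steps lead to the orbit point x k, the signed step reads the digit e k, and f is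
    1 at x k.+1 because that point still has an infinite orbit and so lies in [W 1]. *)
Lemma Q_orbit (e : nat -> bool) (x : nat -> R) k s f : supp 0 f ->
  (forall t, W 1 t -> f t = 1) ->
  (forall j, `|x j| <= 1) -> (forall j, zo (e j) (x j) = x j.+1) ->
  gen k s f (x 0%N) = if e k then 1 else s.
Proof.
move=> sf f1 x1 xe; rewrite /gen (iter_Tr_orbit (e := e))//; last first.
  by apply: (@supp_le 0 1) => //; exact: Tr_supp.
rewrite (@Tr_on _ _ _ (e k)) ?xe// f1 ?mulr1//.
have := @orbit_W (fun j => e (j + k.+1)%N) (fun j => x (j + k.+1)%N) 1.
by apply=> j; [exact: x1|rewrite xe addSn].
Qed.

Lemma ud1_uc1 f f' : (exists B, forall t, `|f' t| <= B) -> ud1 f f' -> uc1 f.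
Proof.
move=> [B fB] uf e e0; have B0 : 0 <= B by apply: le_trans (fB 0).
have [d d0 H] := uf _ ltr01.
have B1 : 0 < B + 1 by lra.
exists (Num.min d (e / (B + 1))); first by rewrite lt_min d0 divr_gt0.
move=> x y; rewrite lt_min => /andP[xd xe].
have := H y (x - y) xd; rewrite subrKC mul1r => h.
have -> : f x - f y = (f x - f y - (x - y) * f' y) + (x - y) * f' y by ring.
apply: (le_trans (ler_normD _ _)); rewrite normrM.
have h2 : `|x - y| * `|f' y| <= `|x - y| * B by exact: ler_wpM2l.
move: xe; rewrite ltr_pdivlMr// => xe; lra.
Qed.

(** * The cut-off profile, a quadratic spline *)

Definition pos_sq (z : R) := Num.max z 0 ^+ 2.
Definition pos_sq' (z : R) := 2 * Num.max z 0.

(** A Taylor remainder that is quadratic uniformly in z. Everything built linearly from [pos_sq]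
    inherits it, which is how [rho_ud1] obtains differentiability uniform in t. *)
Lemma pos_sq_rem (z a : R) : `|pos_sq (z + a) - pos_sq z - a * pos_sq' z| <= a ^+ 2.
Proof.
rewrite /pos_sq /pos_sq' ler_norml; case: (leP z 0) => hz; case: (leP (z + a) 0) => ha; apply/andP; split; nra.
Qed.

Lemma pos_sq'_lip (z a : R) : `|pos_sq' (z + a) - pos_sq' z| <= 2 * `|a|.
Proof.
rewrite /pos_sq' -mulrBr normrM ger0_norm// ler_wpM2l//.
by apply: le_trans (lip_max0 _ _) _; rewrite addrAC subrr add0r.
Qed.

(* A quadratic spline rising from 0 (left of 0) to 1 (right of 1). *)
Definition spl (z : R) := 2 * pos_sq z - 4 * pos_sq (z - 2^-1) + 2 * pos_sq (z - 1).
Definition spl' (z : R) := 2 * pos_sq' z - 4 * pos_sq' (z - 2^-1) + 2 * pos_sq' (z - 1).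

Lemma spl_rem (z a : R) : `|spl (z + a) - spl z - a * spl' z| <= 8 * a ^+ 2.
Proof.
have h c := pos_sq_rem (z - c) a.
have h0 := h 0; have h1 := h 2^-1; have h2 := h 1.
rewrite !subr0 in h0; rewrite /spl /spl' (addrAC z a (- 2^-1)) (addrAC z a (- 1)).
move: h0 h1 h2; rewrite !ler_norml => /andP[? ?] /andP[? ?] /andP[? ?].
by apply/andP; split; lra.
Qed.

Lemma spl'_lip (z a : R) : `|spl' (z + a) - spl' z| <= 16 * `|a|.
Proof.
have h c := pos_sq'_lip (z - c) a.
have h0 := h 0; have h1 := h 2^-1; have h2 := h 1.
rewrite !subr0 in h0; rewrite /spl' (addrAC z a (- 2^-1)) (addrAC z a (- 1)).
move: h0 h1 h2; rewrite !ler_norml => /andP[? ?] /andP[? ?] /andP[? ?].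
by apply/andP; split; lra.
Qed.

Lemma spl_le0 z : z <= 0 -> spl z = 0 /\ spl' z = 0.
Proof.
move=> z0; rewrite /spl /spl' /pos_sq /pos_sq'; case: (leP z 0); case: (leP (z - 2^-1) 0);
  case: (leP (z - 1) 0) => *; split; nra.
Qed.

(** The weights 2, -4, 2 at the nodes 0, 1/2, 1 cancel the quadratic and the linear terms and leave
    the constant 1. *)
Lemma spl_ge1 z : 1 <= z -> spl z = 1 /\ spl' z = 0.
Proof.
move=> z1; rewrite /spl /spl' /pos_sq /pos_sq'.
have -> : Num.max z 0 = z by rewrite max_l; lra.
have -> : Num.max (z - 2^-1) 0 = z - 2^-1 by rewrite max_l; lra.
have -> : Num.max (z - 1) 0 = z - 1 by rewrite max_l; lra.
by split; field.
Qed.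

Lemma spl_01 z : 0 <= spl z <= 1.
Proof.
case: (leP z 0) => [/spl_le0[-> _]|z0]; first by rewrite lexx ler01.
case: (leP 1 z) => [/spl_ge1[-> _]|z1]; first by rewrite lexx ler01.
rewrite /spl /pos_sq (_ : Num.max z 0 = z); last by rewrite max_l; lra.
rewrite (_ : Num.max (z - 1) 0 = 0); last by rewrite max_r; lra.
by case: (leP (z - 2^-1) 0) => h; apply/andP; split; nra.
Qed.

Lemma spl'_bound z : `|spl' z| <= 16.
Proof.
case: (leP z 0) => [/spl_le0[_ ->]|z0]; first by rewrite normr0.
case: (leP 1 z) => [/spl_ge1[_ ->]|z1]; first by rewrite normr0.
have := spl'_lip 0 z; rewrite add0r (spl_le0 (lexx 0)).2 subr0 => h.
by apply: (le_trans h); rewrite gtr0_norm//; lra.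
Qed.

(** Two ramps of width 1/2 - lam, one at each end of [-1, 1]. At every t at least one of them equals
    1, so the sum minus 1 is also their product. *)
Definition rho (t : R) :=
  spl ((2^-1 - lam)^-1 * (1 + t)) + spl ((2^-1 - lam)^-1 * (1 - t)) - 1.
Definition rho' (t : R) := (2^-1 - lam)^-1 *
  (spl' ((2^-1 - lam)^-1 * (1 + t)) - spl' ((2^-1 - lam)^-1 * (1 - t))).

Let k0 : 0 < (2^-1 - lam)^-1. Proof. have l2 := lam2; by rewrite invr_gt0; lra. Qed.
Let k2 : 2 < (2^-1 - lam)^-1.
Proof. by have l0 := lam0; have l2 := lam2; rewrite -[ltLHS]invrK ltf_pV2 ?posrE ?invr_gt0//; lra. Qed.

Lemma rho_far t : 1 < `|t| -> rho t = 0 /\ rho' t = 0.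
Proof.
rewrite /rho /rho'; set k := (2^-1 - lam)^-1; have kp : 0 < k := k0; have kp2 : 2 < k := k2.
rewrite ltr_normr => /orP[] h.
  have [-> ->] : spl (k * (1 + t)) = 1 /\ spl' (k * (1 + t)) = 0 by apply: spl_ge1; nra.
  have [-> ->] : spl (k * (1 - t)) = 0 /\ spl' (k * (1 - t)) = 0 by apply: spl_le0; nra.
  by rewrite subrr mulr0 addr0 subrr.
have [-> ->] : spl (k * (1 - t)) = 1 /\ spl' (k * (1 - t)) = 0 by apply: spl_ge1; nra.
have [-> ->] : spl (k * (1 + t)) = 0 /\ spl' (k * (1 + t)) = 0 by apply: spl_le0; nra.
by rewrite subrr mulr0 add0r subrr.
Qed.

Lemma rho_near t : `|t| <= 2^-1 + lam -> rho t = 1 /\ rho' t = 0.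
Proof.
rewrite ler_norml => /andP[h1 h2]; have l2 := lam2; rewrite /rho /rho'.
have [-> ->] : spl ((2^-1 - lam)^-1 * (1 + t)) = 1 /\ spl' ((2^-1 - lam)^-1 * (1 + t)) = 0.
  by apply: spl_ge1; rewrite mulrC ler_pdivlMr; lra.
have [-> ->] : spl ((2^-1 - lam)^-1 * (1 - t)) = 1 /\ spl' ((2^-1 - lam)^-1 * (1 - t)) = 0.
  by apply: spl_ge1; rewrite mulrC ler_pdivlMr; lra.
by rewrite subrr mulr0 addrK.
Qed.

Lemma rho_01 t : 0 <= rho t <= 1.
Proof.
rewrite /rho; set k := (2^-1 - lam)^-1; have kp : 0 < k := k0; have kp2 : 2 < k := k2.
have /andP[a1 a2] := spl_01 (k * (1 + t)); have /andP[b1 b2] := spl_01 (k * (1 - t)).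
case: (leP 0 t) => t0.
  have [E _] : spl (k * (1 + t)) = 1 /\ spl' (k * (1 + t)) = 0 by apply: spl_ge1; nra.
  by apply/andP; split; lra.
have [E _] : spl (k * (1 - t)) = 1 /\ spl' (k * (1 - t)) = 0 by apply: spl_ge1; nra.
by apply/andP; split; lra.
Qed.

Lemma rho_ud1 : ud1 rho rho'.
Proof.
rewrite /rho /rho'; set k := (2^-1 - lam)^-1; have kp : 0 < k := k0; have kp2 : 2 < k := k2.
move=> e e0; have K0 : 0 < 16 * k ^+ 2 by rewrite mulr_gt0// exprn_gt0.
(* Each of the two ramps contributes a remainder of at most 8 (k a)^2. *)
exists (e / (16 * k ^+ 2)); first exact: divr_gt0.
move=> t a; rewrite ltr_pdivlMr// => ad.
have h1 := spl_rem (k * (1 + t)) (k * a); have h2 := spl_rem (k * (1 - t)) (k * - a).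
rewrite -!mulrDr in h1 h2.
have e1 : 1 + (t + a) = 1 + t + a by ring.
have e2 : 1 - (t + a) = 1 - t + - a by ring.
rewrite e1 e2.
apply: (@le_trans _ _ (8 * (k * a) ^+ 2 + 8 * (k * - a) ^+ 2)).
  move: h1 h2; rewrite !ler_norml => /andP[? ?] /andP[? ?]; apply/andP; split; lra.
have -> : 8 * (k * a) ^+ 2 + 8 * (k * - a) ^+ 2 = `|a| * (16 * k ^+ 2) * `|a|.
  have : `|a| ^+ 2 = a ^+ 2 by rewrite real_normK// num_real.
  by rewrite !expr2; nra.
by apply: ler_wpM2r => //; exact: ltW.
Qed.

Lemma rho'_bounded : exists B, forall t, `|rho' t| <= B.
Proof.
exists ((2^-1 - lam)^-1 * 32) => t; rewrite /rho' normrM (gtr0_norm k0).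
apply: ler_wpM2l; first exact: ltW k0.
have := spl'_bound ((2^-1 - lam)^-1 * (1 + t)).
have := spl'_bound ((2^-1 - lam)^-1 * (1 - t)).
set x := spl' _; set y := spl' _; have := ler_normB y x; lra.
Qed.

Lemma rho_cu1 : cu1 1 rho.
Proof.
split=> //; first by move=> t /rho_far[].
  by exists 1 => t; have /andP[h1 h2] := rho_01 t; rewrite ger0_norm.
exact: ud1_uc1 rho'_bounded rho_ud1.
Qed.

Lemma rho'_cu1 : cu1 1 rho'.
Proof.
split=> //; [by move=> t /rho_far[]|exact: rho'_bounded|].
rewrite /rho'; set k := (2^-1 - lam)^-1; have kp : 0 < k := k0; have kp2 : 2 < k := k2.
move=> e e0; have K0 : 0 < 32 * k ^+ 2 by rewrite mulr_gt0// exprn_gt0.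
exists (e / (32 * k ^+ 2)); first exact: divr_gt0.
move=> x y; rewrite ltr_pdivlMr// => xy.
have := spl'_lip (k * (1 + y)) (k * (x - y)).
have := spl'_lip (k * (1 - y)) (k * - (x - y)).
rewrite -!mulrDr (_ : 1 - y - (x - y) = 1 - x); last by ring.
rewrite (_ : 1 + y + (x - y) = 1 + x); last by ring.
rewrite -mulrBr !normrM normrN (gtr0_norm kp) => h1 h2.
set X := spl' _ in h1 h2 *; set Y := spl' _ in h1 h2 *.
set Z := spl' _ in h1 h2 *; set V := spl' _ in h1 h2 *.
have h3 : `|Z - X - (V - Y)| <= `|Z - V| + `|X - Y|.
  by rewrite (_ : Z - X - (V - Y) = (Z - V) - (X - Y)) ?ler_normB//; ring.
have E : `|x - y| * (32 * k ^+ 2) = k * (32 * (k * `|x - y|)) by ring.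
rewrite E in xy; apply: le_trans (ltW xy); apply: ler_wpM2l; first exact: ltW.
apply: (le_trans h3); lra.
Qed.

End Levels.

(** * Signed series whose terms decay at least geometrically with ratio below 1/2 *)

Section SignedSeries.
Variables (R : realType) (r : R).
Hypotheses (r0 : 0 < r) (r2 : r < 2^-1).
Implicit Types (a w : nat -> R).

Definition geo a := (forall k, 0 <= a k) /\ forall k, a k.+1 <= r * a k.

Definition ssum a w : R := limn (series (fun k => w k * a k)).

Lemma geo_shift a : geo a -> geo (fun k => a k.+1).
Proof. by case=> h1 h2; split=> k. Qed.

Lemma geo_shiftn a N : geo a -> geo (fun k => a (N + k)%N).
Proof. by case=> h1 h2; split=> k //; rewrite addnS. Qed.

Lemma geo_le a k : geo a -> a k <= a 0%N * r ^+ k.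
Proof.
move=> [a0 ar]; elim: k => [|k IH]; first by rewrite expr0 mulr1.
by apply: (le_trans (ar k)); rewrite exprS mulrCA ler_wpM2l// ltW.
Qed.

Lemma geo_anti a j k : geo a -> (j <= k)%N -> a k <= a j.
Proof.
have rr := r2; move=> [a0 ar] /subnK <-; elim: (k - j)%N => [//|m IH]; rewrite addSn.
apply: le_trans IH; apply: (le_trans (ar _)); rewrite -[leRHS]mul1r ler_wpM2r//; lra.
Qed.

Lemma geo_partial a n : geo a -> \sum_(0 <= k < n) a k <= a 0%N / (1 - r).
Proof.
have rr := r2; move=> [a0 ar].
have p0 : 0 < 1 - r by lra.
(* The added term majorizes the whole tail from n on, which makes the bound inductive. *)
suff : \sum_(0 <= k < n) a k + a n / (1 - r) <= a 0%N / (1 - r).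
  by apply: le_trans; rewrite lerDl divr_ge0// ltW.
elim: n => [|n IH]; first by rewrite big_nil add0r.
rewrite big_nat_recr//= -addrA; apply: le_trans IH; rewrite lerD2l.
have : a n.+1 / (1 - r) <= r * a n / (1 - r) by rewrite ler_pM2r ?invr_gt0.
have -> : a n / (1 - r) = a n + r * a n / (1 - r) by field; lra.
lra.
Qed.

Lemma ssum_partial a w n : geo a -> (forall k, `|w k| <= 1) ->
  `|series (fun k => w k * a k) n| <= a 0%N / (1 - r).
Proof.
move=> ga w1; apply: le_trans (geo_partial n ga).
rewrite /series /=; apply: (le_trans (ler_norm_sum _ _ _)); apply: ler_sum => k _.
rewrite normrM (ger0_norm (ga.1 k)) -[leRHS]mul1r; apply: ler_wpM2r => //; exact: ga.1.
Qed.

Lemma ssum_cvg a w : geo a -> (forall k, `|w k| <= 1) ->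
  cvgn (series (fun k => w k * a k)).
Proof.
move=> ga w1; apply: normed_cvg.
have H n : [normed series (fun k => w k * a k)] n <= a 0%N / (1 - r).
  apply: le_trans (geo_partial n ga).
  rewrite /series /=; apply: ler_sum => k _.
  rewrite normrM (ger0_norm (ga.1 k)) -[leRHS]mul1r; apply: ler_wpM2r => //; exact: ga.1.
apply: nondecreasing_is_cvgn.
  by apply: nondecreasing_series => k _ _; exact: normr_ge0.
by exists (a 0%N / (1 - r)) => _ /= [n _ <-]; exact: H.
Qed.

Lemma ssum_bound a w : geo a -> (forall k, `|w k| <= 1) ->
  `|ssum a w| <= a 0%N / (1 - r).
Proof.
move=> ga w1; have cs := ssum_cvg ga w1; rewrite ler_norml; apply/andP; split.
  apply: limr_ge => //; near=> n; have := ssum_partial n ga w1.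
  by rewrite ler_norml => /andP[].
apply: limr_le => //; near=> n; have := ssum_partial n ga w1.
by rewrite ler_norml => /andP[].
Unshelve. all: by end_near. Qed.

Lemma ssum_recl a w : geo a -> (forall k, `|w k| <= 1) ->
  ssum a w = w 0%N * a 0%N + ssum (fun k => a k.+1) (fun k => w k.+1).
Proof.
move=> ga w1; have cs := ssum_cvg ga w1.
have cs' := @ssum_cvg (fun k => a k.+1) (fun k => w k.+1) (geo_shift ga) (fun k => w1 k.+1).
rewrite /ssum; apply/cvg_lim => //.
rewrite -(cvg_shiftS _).
have -> : [sequence series (fun k => w k * a k) n.+1]_n =
    (fun n => w 0%N * a 0%N + series (fun k => w k.+1 * a k.+1) n).
  by apply/funext => n; rewrite /series /= big_nat_recl.
by apply: cvgD; [exact: cvg_cst|exact: cs'].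
Qed.

Lemma ssum_split a w N : geo a -> (forall k, `|w k| <= 1) ->
  ssum a w = \sum_(0 <= k < N) w k * a k +
             ssum (fun k => a (N + k)%N) (fun k => w (N + k)%N).
Proof.
elim: N a w => [|N IH] a w ga w1; first by rewrite big_nil add0r.
rewrite ssum_recl// big_nat_recl//= -addrA; congr (_ + _).
rewrite (IH _ _ (geo_shift ga) (fun k => w1 k.+1)).
by congr (_ + ssum _ _); apply/funext => k; rewrite addSn.
Qed.

Lemma ssum_tail a w N : geo a -> (forall k, `|w k| <= 1) ->
  `|ssum a w - \sum_(0 <= k < N) w k * a k| <= a 0%N * r ^+ N / (1 - r).
Proof.
have rr := r2; move=> ga w1; rewrite (ssum_split N ga w1) addrAC subrr add0r.
apply: (le_trans (ssum_bound (geo_shiftn N ga) (fun k => w1 _))).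
rewrite addn0 ler_pM2r ?invr_gt0; [exact: geo_le|lra].
Qed.

Lemma sgn_norm b : `|sgn R b| = 1.
Proof. by case: b; rewrite /sgn ?normrN normr1. Qed.

Lemma sgn_le1 (e : nat -> bool) k : `|sgn R (e k)| <= 1.
Proof. by rewrite sgn_norm. Qed.

(** At the first disagreement i the terms differ by 2 a_i. Each tail is at most r a_i / (1 - r) <= 2
    r a_i since r < 1/2, so a distance of at least 2 (1 - 2 r) a_i remains, and a_i >= a_j >=
    a_k. *)
Lemma ssum_sep a (e e' : nat -> bool) j k : geo a -> e j != e' j -> (j <= k)%N ->
  (1 - 2 * r) * a k <= `|ssum a (fun i => sgn R (e i)) - ssum a (fun i => sgn R (e' i))|.
Proof.
have rr := r2; have rr0 := r0.
move=> ga ee jk; apply: (@le_trans _ _ ((1 - 2 * r) * a j)).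
  by rewrite ler_wpM2l ?(geo_anti ga)//; lra.
have E0 b (c : nat -> bool) : geo b -> ssum b (fun i => sgn R (c i)) =
    sgn R (c 0%N) * b 0%N + ssum (fun i => b i.+1) (fun i => sgn R (c i.+1)).
  by move=> gb; exact: ssum_recl gb (sgn_le1 c).
have base b (c c' : nat -> bool) : geo b -> c 0%N != c' 0%N -> (1 - 2 * r) * b 0%N <=
    `|ssum b (fun i => sgn R (c i)) - ssum b (fun i => sgn R (c' i))|.
  move=> {a e e' j k ga ee jk} ga ee.
  rewrite (E0 _ c ga) (E0 _ c' ga).
  have p0 : 0 < 1 - r by lra.
  have h1 := ssum_bound (geo_shift ga) (sgn_le1 (fun i => c i.+1)).
  have h2 := ssum_bound (geo_shift ga) (sgn_le1 (fun i => c' i.+1)).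
  set X := ssum _ _ in h1 *; set Y := ssum _ _ in h2 *.
  have a1 := ga.2 0%N; have a0 := ga.1 0%N.
  have E : b 1%N / (1 - r) <= r * b 0%N / (1 - r) by rewrite ler_pM2r ?invr_gt0.
  have E2 : r * b 0%N / (1 - r) <= 2 * (r * b 0%N).
    rewrite ler_pdivrMr//; have : 0 <= r * b 0%N by rewrite mulr_ge0// ltW.
    nra.
  have -> : sgn R (c' 0%N) = - sgn R (c 0%N).
    by move: ee; case: (c 0%N); case: (c' 0%N) => //; rewrite /sgn opprK.
  set s := sgn R _; have s1 : `|s| = 1 := sgn_norm _.
  have -> : s * b 0%N + X - (- s * b 0%N + Y) = s * (2 * b 0%N) - (Y - X) by ring.
  apply: le_trans (lerB_dist _ _).
  rewrite normrM s1 mul1r ger0_norm; last by lra.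
  have h3 := ler_normB Y X.
  have h4 : `|X| <= r * b 0%N / (1 - r) by exact: le_trans E.
  have h5 : `|Y| <= r * b 0%N / (1 - r) by exact: le_trans E.
  have E3 : 0 <= (1 - 2 * r) * b 0%N by rewrite mulr_ge0//; lra.
  have E4 : 0 <= r * b 0%N by rewrite mulr_ge0// ltW.
  lra.
elim: j a e e' ga ee {k jk} => [|j IH] a e e' ga ee; last first.
  have [e0|e0] := eqVneq (e 0%N) (e' 0%N).
    rewrite (E0 _ e ga) (E0 _ e' ga) e0 opprD addrACA subrr add0r.
    exact: (IH (fun k => a k.+1) (fun k => e k.+1) (fun k => e' k.+1) (geo_shift ga)).
  apply: (@le_trans _ _ ((1 - 2 * r) * a 0%N)); last exact: base.
  by rewrite ler_wpM2l ?(geo_anti ga)//; lra.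
exact: base.
Qed.

End SignedSeries.

(** * Euclidean diameters, binary digits and lower bounds for Hausdorff measures *)

Section Hausdorff.
Variable R : realType.

Lemma enorm_coord k (v : 'rV[R]_k) i : `|v ord0 i| <= enorm v.
Proof.
rewrite /enorm -sqrtr_sqr ler_wsqrtr// (bigD1 i)//= lerDl.
by apply: sumr_ge0 => j _; exact: sqr_ge0.
Qed.

Lemma enorm_le k (v : 'rV[R]_k) (c : R) : 0 <= c -> (forall i, `|v ord0 i| <= c) ->
  enorm v <= k%:R * c.
Proof.
move=> c0 vc; rewrite -[leRHS]ger0_norm ?mulr_ge0// -sqrtr_sqr ler_wsqrtr//.
apply: (@le_trans _ _ (\sum_(i < k) c ^+ 2)).
  apply: ler_sum => i _; rewrite -(real_normK (num_real _)).
  by apply: lerXn2r; rewrite ?nnegrE.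
rewrite sumr_const card_ord -[leLHS]mulr_natl exprMn ler_wpM2r ?sqr_ge0//.
by rewrite -natrX ler_nat; case: k {v vc} => // k; rewrite leq_pmulr.
Qed.

Lemma ediam_ge0 k (A : set 'rV[R]_k) : (0 <= ediam A)%E.
Proof. by apply: ereal_sup_ubound; left. Qed.

Lemma ediam_ub k (A : set 'rV[R]_k) x y : A x -> A y -> ((enorm (x - y))%:E <= ediam A)%E.
Proof. by move=> Ax Ay; apply: ereal_sup_ubound; right; exists x => //; exists y. Qed.

Lemma ediam_le k (A : set 'rV[R]_k) (c : R) : 0 <= c ->
  (forall x y, A x -> A y -> enorm (x - y) <= c) -> (ediam A <= c%:E)%E.
Proof.
move=> c0 Ac; apply: ub_ereal_sup => _ [->|[x Ax [y Ay <-]]]; first by rewrite lee_fin.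
by rewrite lee_fin; exact: Ac.
Qed.

Lemma ediam_set0 k : ediam (set0 : set 'rV[R]_k) = 0%E.
Proof. by apply/eqP; rewrite eq_le ediam_ge0 ediam_le. Qed.

(** For t in [0, 1[ the truncated number is the integer written by the first j + 1 binary digits of
    t, and its parity is the last of them. *)
Definition bit (t : R) (j : nat) : bool := odd (Num.truncn (t * 2 ^+ j.+1)).

Lemma truncn_half (x : R) : 0 <= x -> Num.truncn x = (Num.truncn (x * 2))./2.
Proof.
move=> x0; set m := Num.truncn (x * 2).
have /truncn_itv/andP[] : 0 <= x * 2 by rewrite mulr_ge0.
rewrite -/m => h1 h2; apply: truncn_def.
have E : (m%:R : R) = (odd m)%:R + 2 * (m./2)%:R.
  by rewrite -[in LHS](odd_double_half m) natrD -muln2 natrM mulrC.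
have o1 : (0 : R) <= (odd m)%:R <= (1 : R) by case: odd; rewrite ?lexx ?ler01.
rewrite -[m.+1]addn1 natrD in h2; rewrite -[_.+1]addn1 natrD.
by case/andP: o1 => ? ?; apply/andP; split; lra.
Qed.

Lemma bit_trunc (s t : R) N : 0 <= s < 1 -> 0 <= t < 1 ->
  (forall j, (j < N)%N -> bit s j = bit t j) ->
  Num.truncn (s * 2 ^+ N) = Num.truncn (t * 2 ^+ N).
Proof.
move=> s01 t01; elim: N => [_|N IH st].
  have z (x : R) : 0 <= x < 1 -> Num.truncn (x * 2 ^+ 0) = 0%N.
    by move=> x01; rewrite expr0 mulr1; apply: truncn_def.
  by rewrite !z.
have h (x : R) : 0 <= x < 1 -> Num.truncn (x * 2 ^+ N.+1) =
    (bit x N + (Num.truncn (x * 2 ^+ N)).*2)%N.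
  move=> /andP[x0 _]; rewrite (@truncn_half (x * 2 ^+ N)) ?mulr_ge0 ?exprn_ge0//.
  by rewrite -mulrA -exprSr odd_double_half.
rewrite !h// (st N (ltnSn N)) IH// => j jN; apply: st; exact: ltnW.
Qed.

Lemma bit_close (s t : R) N : 0 <= s < 1 -> 0 <= t < 1 ->
  (forall j, (j < N)%N -> bit s j = bit t j) -> `|s - t| <= 2 ^- N.
Proof.
move=> s01 t01 /(bit_trunc s01 t01) E.
have p0 : (0 : R) < 2 ^+ N by exact: exprn_gt0.
have h (x : R) : 0 <= x < 1 -> 0 <= x * 2 ^+ N by case/andP=> ? _; rewrite mulr_ge0// ltW.
have /truncn_itv := h _ s01; have /truncn_itv := h _ t01; rewrite E.
set m := Num.truncn _; rewrite -[m.+1]addn1 natrD => /andP[h1 h2] /andP[h3 h4].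
rewrite -[leLHS](mulfK (lt0r_neq0 p0)) -[leRHS]mul1r ler_pM2r ?invr_gt0//.
rewrite -[X in _ * X](gtr0_norm p0) -normrM ler_norml mulrBl; apply/andP; split; lra.
Qed.

(* Mass distribution principle for the image of the fair coin-tossing measure:
   Lebesgue measure on [0, 1[ is transported through binary digits. *)
Lemma mass_distribution n (psi : R -> R) (M : R) (y : (nat -> bool) -> 'rV[R]_n)
  (E : set 'rV[R]_n) (gap : nat -> R) (K : nat) :
  (0 < n)%N -> 0 <= M -> (forall d, E (y d)) ->
  (forall s t, 0 <= s -> s <= t -> psi s <= psi t) -> psi 0 = 0 ->
  (forall k, 0 < gap k) -> (forall j k, (j <= k)%N -> gap k <= gap j) ->
  (forall e, 0 < e -> exists k, gap k < e) ->
  (forall d d' k i, (i < n * k.+1)%N -> d i != d' i -> gap k <= enorm (y d - y d')) ->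
  (forall k, (K <= k)%N -> M * 2 ^- (n * k.+1) <= psi (gap k.+1)) ->
  ((M / 2)%:E <= hausdorff psi E)%E.
Proof.
move=> n0 M0 yE psim psi0 gp ga gl sep Mpsi.
have psi_ge0 s : 0 <= s -> 0 <= psi s by move=> s0; rewrite -psi0; exact: psim.
(* One scale suffices, [hausdorff] being a supremum over scales. A set of diameter at most gap K / 2
   is smaller than the gap of generation K, hence is treated at a generation where the bound on psi
   holds. *)
apply: (@le_trans _ _ (hausdorff_pre psi (gap K / 2) E)); last first.
  apply: ereal_sup_ubound; exists (gap K / 2) => //=.
  by rewrite in_itv /= andbT divr_gt0.
apply: le_ereal_inf_tmp => _ [F [Fd FE] <-].
have dF i : exists2 D : R, 0 <= D <= gap K / 2 & ediam (F i) = D%:E.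
  have := Fd i; have := ediam_ge0 (F i); case: (ediam (F i)) => [D||]//.
  by rewrite !lee_fin => h1 h2; exists D; rewrite ?h1.
pose T i := [set t : R | 0 <= t < 1 /\ F i (y (bit t))].
have close i D k s t : ediam (F i) = D%:E -> D < gap k -> T i s -> T i t ->
    `|s - t| <= 2 ^- (n * k.+1).
  move=> ED Dk [s01 Fs] [t01 Ft]; apply: bit_close => // j jN.
  apply/eqP/negPn/negP => /(sep _ _ _ _ jN); apply/negP; rewrite -ltNge.
  by apply: le_lt_trans Dk; rewrite -lee_fin -ED; exact: ediam_ub.
(* The parameter set [T i] is not known to be measurable, so it is enclosed in the empty set, a
   point or an interval. The interval is centred at a point of [T i] and has length twice its
   radius: this is the factor 2 here and the origin of M / 2 in the conclusion. *)
have Bex i : exists B : set R, [/\ measurable (B : set (measurableTypeR R)), T i `<=` B &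
    (M%:E * (@lebesgue_measure R) B <= (2 * psi (fine (ediam (F i))))%:E)%E].
  have [D /andP[D0 DK] ED] := dF i; rewrite ED /=.
  have [T0|/set0P[t0 Tt0]] := eqVneq (T i) set0.
    exists set0; rewrite T0; split=> //.
    by rewrite measure0 mule0 lee_fin mulr_ge0// psi_ge0.
  (* Diameter 0 is below every gap, so all digits agree and [T i] is a single point; its null
     measure matches psi 0 = 0. *)
  have [Dz|Dn] := eqVneq D 0.
    exists [set t0]; split=> //; last first.
      by rewrite lebesgue_measure_set1 mule0 lee_fin mulr_ge0// psi_ge0.
    move=> t Tt /=; apply/eqP; rewrite -subr_eq0 -normr_le0.
    apply/ler_addgt0Pl => e e0; rewrite addr0.
    have [m me] : exists m, 2 ^- m < e :> R.
      have h : @GRing.exp R 2^-1 @ \oo --> (0 : R).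
        by apply: cvg_expr; rewrite ger0_norm; lra.
      have /cvgrPdist_lt/(_ e e0)[N _ HN] := h.
      exists N; have := HN N (leqnn N).
      by rewrite /= sub0r normrN ger0_norm ?exprn_ge0// exprVn.
    have := close i D m t t0 ED; rewrite Dz => /(_ (gp m) Tt Tt0) /le_trans; apply.
    apply: le_trans (ltW me); rewrite lef_pV2 ?posrE ?exprn_gt0//.
    rewrite ler_eXn2l ?ltr1n//.
    by apply: leq_trans (leqnSn m) _; rewrite leq_pmull.
  have Dp : 0 < D by rewrite lt_neqAle eq_sym Dn.
  have ex : exists k, gap k <= D by have [k /ltW h] := gl D Dp; exists k.
  (* At the least generation with gap at most D, minimality puts D below the preceding gap, which
     brings the parameters close together, while the gap itself bounds psi D from below. *)
  case: (ex_minnP ex) => k gk kmin.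
  have Kk : (K < k)%N.
    rewrite ltnNge; apply/negP => /(ga _ _) h; have := gp K; lra.
  case: k gk kmin Kk => // k gk kmin; rewrite ltnS => Kk.
  have Dk : D < gap k by rewrite ltNge; apply/negP => /kmin; rewrite ltnn.
  exists `[t0 - 2 ^- (n * k.+1), t0 + 2 ^- (n * k.+1)]%classic; split.
  - exact: measurable_itv.
  - move=> t Tt /=; rewrite in_itv /= -ler_distl.
    exact: close ED Dk Tt Tt0.
  - rewrite lebesgue_measure_itv /= lte_fin.
    have h0 : (0 : R) < 2 ^- (n * k.+1) by rewrite invr_gt0 exprn_gt0.
    rewrite ifT; last by lra.
    rewrite -EFinB -EFinM lee_fin.
    have := Mpsi k Kk; have := psim _ _ (ltW (gp k.+1)) gk; lra.
pose B i := projT1 (cid (Bex i)).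
have BP i := projT2 (cid (Bex i)).
have cov : `[0, 1[%classic `<=` \bigcup_i B i.
  move=> t; rewrite /= in_itv /= => t01.
  have [i _ Fi] := FE _ (yE (bit t)); exists i => //.
  by have [_ + _] := BP i; apply; split.
have := @measure_sigma_subadditive _ _ _ (@lebesgue_measure R) `[0, 1[%classic B.
move=> /(_ _ _ cov) H.
have {}H : (1%:E <= \sum_(0 <= i <oo) (@lebesgue_measure R) (B i))%E.
  have : ((@lebesgue_measure R) `[0%R, 1%R[ <= \sum_(i <oo) (@lebesgue_measure R) (B i))%E.
    apply: H; last exact: measurable_itv.
    by move=> i; have [] := BP i.
  by rewrite lebesgue_measure_itv /= lte_fin ltr01 oppr0 adde0.
have S0 : (0 <= \sum_(0 <= i <oo) (psi (fine (ediam (F i))))%:E)%E.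
  apply: nneseries_ge0 => i _ _; rewrite lee_fin psi_ge0// fine_ge0//; exact: ediam_ge0.
have HM : (M%:E <= 2%:E * \sum_(0 <= i <oo) (psi (fine (ediam (F i))))%:E)%E.
  rewrite -nneseriesZl; last first.
    by move=> i _; rewrite lee_fin psi_ge0// fine_ge0//; exact: ediam_ge0.
  apply: (@le_trans _ _ (M%:E * \sum_(0 <= i <oo) (@lebesgue_measure R) (B i))%E).
    by rewrite -[leLHS]mule1 lee_wpmul2l// lee_fin.
  rewrite -nneseriesZl; last by move=> i _; exact: measure_ge0.
  apply: lee_nneseries => [i _|i _].
    by rewrite mule_ge0// lee_fin.
  by rewrite -EFinM; have [_ _] := BP i.
move: HM S0; case: (\sum_(0 <= i <oo) _)%E => [S||]//=; last by move=> *; rewrite leey.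
by rewrite -EFinM !lee_fin => ? ?; lra.
Qed.

End Hausdorff.

(** * The Cantor set E and its alpha-dimensional measure *)

Section CantorSet.
Variables (R : realType) (lam : R) (n : nat).
Hypotheses (lam0 : 0 < lam) (lam2 : lam < 2^-1).

Definition CE : set 'rV[R]_n := [set x | forall l k, W lam k (x ord0 l)].

Lemma zo_continuous b : continuous (zo lam b).
Proof.
move=> t; rewrite /zo; apply: cvgM; first exact: cvg_cst.
by apply: cvgB; [exact: cvg_id|exact: cvg_cst].
Qed.

Lemma W_closed k : closed [set t : R | W lam k t].
Proof.
elim: k => [|k IH] /=.
  have -> : [set t : R | `|t| <= 1] = `[-1, 1]%classic.
    by apply/seteqP; split=> t /=; rewrite in_itv /= ler_norml.
  exact: itv_closed.
have -> : [set t | W lam k (zo lam true t) \/ W lam k (zo lam false t)] =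
   zo lam true @^-1` [set t | W lam k t] `|` zo lam false @^-1` [set t | W lam k t] by [].
by apply: closedU; apply: preimage_closed => // x _; exact: zo_continuous.
Qed.

Lemma CE_compact : compact CE.
Proof.
have -> : CE = [set v : 'rV[R]_n | forall i, (fun _ => \bigcap_k [set t : R | W lam k t]) i (v ord0 i)].
  by apply/seteqP; split=> v /= h l => [k _|k]; [exact: h|exact: (h l k)].
apply: (@rV_compact R n (fun _ => \bigcap_k [set t : R | W lam k t])) => _.
apply: (@subclosed_compact R _ (`[-1, 1]%classic : set R)).
- by apply: closed_bigI => k _; exact: W_closed.
- exact: segment_compact.
- by move=> t /(_ 0%N I) /=; rewrite in_itv /= ler_norml.
Qed.

Definition cen (w : seq bool) : R := foldr (fun b c => sgn R b / 2 + lam * c) 0 w.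

Lemma W_cover k t : W lam k t -> exists w : k.-tuple bool, `|t - cen w| <= lam ^+ k.
Proof.
elim: k t => [|k IH] t.
  by move=> h; exists [tuple]; rewrite subr0 expr0.
move=> /W_case[b /IH[w hw]]; exists [tuple of b :: w] => /=.
rewrite {1}(zoK lam0 b t) opprD addrACA subrr add0r -mulrBr normrM gtr0_norm//.
by rewrite exprS ler_pM2l.
Qed.

Lemma ssumZ (r c : R) a w : r < 2^-1 -> geo r a -> (forall k, `|w k| <= 1) ->
  ssum (fun k => c * a k) w = c * ssum a w.
Proof.
move=> r2 ga w1; rewrite /ssum; apply/cvg_lim => //.
have -> : series (fun k => w k * (c * a k)) = fun m => c * series (fun k => w k * a k) m.
  apply/funext => m; rewrite /series /= mulr_sumr; apply: eq_bigr => k _; ring.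
by apply: cvgM; [exact: cvg_cst|exact: (ssum_cvg r2 ga w1)].
Qed.

(** Iterating the similarities t |-> +-1/2 + lam t writes a point of the Cantor set as a series of
    terms +- lam^k / 2. *)
Definition aE (k : nat) : R := lam ^+ k / 2.

Lemma geo_aE : geo lam aE.
Proof.
split=> k; first by rewrite /aE divr_ge0// exprn_ge0// ltW.
by rewrite /aE exprS mulrA.
Qed.

Definition cpt (e : nat -> bool) : R := ssum aE (fun k => sgn R (e k)).

Lemma cpt_norm e : `|cpt e| <= 1.
Proof.
have l2 := lam2; apply: (le_trans (ssum_bound lam2 geo_aE (sgn_le1 R e))).
rewrite /aE expr0 ler_pdivrMr; lra.
Qed.

Lemma cpt_zo e : zo lam (e 0%N) (cpt e) = cpt (fun k => e k.+1).
Proof.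
rewrite {1}/cpt (ssum_recl lam2 geo_aE (sgn_le1 R e)).
have -> : (fun k => aE k.+1) = fun k => lam * aE k.
  by apply/funext => k; rewrite /aE exprS mulrA.
rewrite (ssumZ _ lam2 geo_aE (sgn_le1 R (fun k => e k.+1))).
rewrite /zo /aE expr0 mul1r addrAC subrr add0r mulKf// gt_eqF//.
Qed.

Lemma cpt_orbit e j : zo lam (e j) (cpt (fun k => e (j + k)%N)) = cpt (fun k => e (j.+1 + k)%N).
Proof.
rewrite -{1}[j]addn0 (cpt_zo (fun k => e (j + k)%N)).
by congr cpt; apply/funext => k; rewrite addnS.
Qed.

(** Interleaving: one binary sequence codes all n coordinates, and its first n (k + 1) entries are
    the digits 0 to k of every coordinate. *)
Definition digits (d : nat -> bool) (i : nat) : nat -> bool := fun k => d (i + n * k)%N.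

Definition yE (d : nat -> bool) : 'rV[R]_n := \row_i cpt (digits d i).

Lemma yE_CE d : CE (yE d).
Proof.
move=> l k; rewrite mxE.
have := @orbit_W R lam (digits d l) (fun j => cpt (fun k => digits d l (j + k)%N)) k.
apply=> j; [exact: cpt_norm|exact: cpt_orbit].
Qed.

(** Entry i is digit i div n of coordinate i mod n, and i div n <= k. The weights are arbitrary so
    that the lemma serves both E and its image. *)
Lemma digits_sep (a : nat -> R) (r : R) (d d' : nat -> bool) k i :
  0 < r -> r < 2^-1 -> geo r a ->
  (i < n * k.+1)%N -> d i != d' i ->
  (1 - 2 * r) * a k <=
    enorm (\row_j ssum a (fun k => sgn R (digits d j k))
           - \row_j ssum a (fun k => sgn R (digits d' j k)) : 'rV[R]_n).
Proof.
move=> r0 r2 ga ik dd.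
have n0 : (0 < n)%N by case: (n) ik.
have im : (i %% n < n)%N by rewrite ltn_mod.
apply: le_trans (enorm_coord _ (Ordinal im)); rewrite !mxE /=.
apply: (@ssum_sep R r r0 r2 a (digits d (i %% n)) (digits d' (i %% n)) (i %/ n) k) => //.
  by rewrite /digits addnC mulnC -divn_eq.
by rewrite -ltnS ltn_divLR// mulnC.
Qed.

Variable alpha : R.
Hypotheses (alpha0 : 0 < alpha) (lamE : lam `^ alpha = 2 ^- n) (n0 : (0 < n)%N).

Lemma lamX k : (lam ^+ k) `^ alpha = 2 ^- (n * k).
Proof.
have -> : (lam ^+ k) `^ alpha = (lam `^ alpha) ^+ k.
  elim: k => [|k IH]; first by rewrite !expr0 powR1.
  by rewrite !exprS powRM ?IH ?exprn_ge0// ltW.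
by rewrite lamE exprVn exprM.
Qed.

Lemma hausdorff_CE_gt0 : (0 < hausdorff (fun r : R => (r `^ alpha)%R) CE)%E.
Proof.
have l2 := lam2; have l0 := lam0.
(* With this constant the separation of generation k is exactly c lam^k, whose power alpha is
   c^alpha 2^-(n k). *)
pose c := (1 - 2 * lam) / 2.
have c0 : 0 < c by rewrite /c; lra.
pose M := c `^ alpha * 2 ^- n.
have M0 : 0 < M by rewrite mulr_gt0 ?powR_gt0// invr_gt0 exprn_gt0.
apply: (@lt_le_trans _ _ ((M / 2)%:E)); first by rewrite lte_fin divr_gt0.
apply: (@mass_distribution R n _ M yE _ (fun k => (1 - 2 * lam) * aE k) 0) => //.
- exact: ltW.
- exact: yE_CE.
- by move=> s t s0 st; apply: ge0_ler_powR; rewrite ?nnegrE//; [exact: ltW|exact: le_trans st].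
- by rewrite powR0// gt_eqF.
- by move=> k; rewrite mulr_gt0 ?divr_gt0 ?exprn_gt0//; lra.
- move=> j k jk; rewrite ler_wpM2l//; first lra.
  exact: (geo_anti lam2 geo_aE).
- move=> e e0.
  have h : @GRing.exp R lam @ \oo --> (0 : R).
    by apply: cvg_expr; rewrite ger0_norm; lra.
  have /cvgrPdist_lt/(_ e e0)[N _ HN] := h.
  exists N; have := HN N (leqnn N).
  rewrite /= sub0r normrN ger0_norm ?exprn_ge0//; last by lra.
  rewrite /aE; have : 0 < lam ^+ N by rewrite exprn_gt0.
  nra.
- by move=> d d' k i; exact: (digits_sep lam0 lam2 geo_aE).
- move=> k _; have -> : (1 - 2 * lam) * aE k.+1 = c * lam ^+ k.+1.
    by rewrite /aE /c; field.
  rewrite powRM ?exprn_ge0 ?(ltW c0) ?(ltW lam0)// lamX.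
  rewrite /M -mulrA ler_pM2l ?powR_gt0// -[leRHS]mul1r ler_pM2r ?invr_gt0 ?exprn_gt0//.
  by rewrite invf_le1 ?exprn_gt0// exprn_ege1// ler1n.
Qed.

(** Generation k covers E by 2^(n k) cells of diameter at most 2 n lam^k; as lam^alpha = 2^-n, the
    total cost is at most (2 n)^alpha for every k. *)
Lemma hausdorff_CE_fin : (hausdorff (fun r : R => (r `^ alpha)%R) CE < +oo)%E.
Proof.
have l2 := lam2; have l0 := lam0.
apply: (@le_lt_trans _ _ ((n%:R * 2) `^ alpha)%:E); last exact: ltry.
apply: ub_ereal_sup => z [delta dd <-]; move: dd; rewrite /= in_itv /= andbT => d0.
have nn : 0 < n%:R * 2 :> R by rewrite mulr_gt0// ltr0n.
have [k hk] : exists k, lam ^+ k < delta / (n%:R * 2).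
  have h : @GRing.exp R lam @ \oo --> (0 : R).
    by apply: cvg_expr; rewrite ger0_norm; lra.
  have /cvgrPdist_lt/(_ _ (divr_gt0 d0 nn))[N _ HN] := h.
  exists N; have := HN N (leqnn N).
  by rewrite /= sub0r normrN ger0_norm ?exprn_ge0//; lra.
have lk0 : 0 < lam ^+ k by rewrite exprn_gt0.
pose Wd : finType := {ffun 'I_n -> k.-tuple bool}.
(* The finite cover becomes a sequence; indices past the number of addresses give empty sets, whose
   cost is 0 because alpha is positive. *)
pose F (i : nat) : set 'rV[R]_n := [set x | exists w : Wd, i = enum_rank w /\
   forall l, `|x ord0 l - cen (w l)| <= lam ^+ k].
have Fd i : (ediam (F i) <= (n%:R * 2 * lam ^+ k)%:E)%E.
  apply: ediam_le; first by rewrite mulr_ge0 ?ltW.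
  move=> x y [w [iw xw]] [w' [iw' yw']].
  have ww : w' = w by apply: enum_rank_inj; apply: val_inj; rewrite /= -iw.
  rewrite ww in yw'; rewrite -mulrA; apply: enorm_le; first by rewrite mulr_ge0// ltW.
  move=> l; rewrite !mxE.
  have := xw l; have := yw' l; rewrite !ler_norml => /andP[? ?] /andP[? ?].
  by apply/andP; split; lra.
apply: (@le_trans _ _ (\sum_(0 <= i <oo) ((fine (ediam (F i))) `^ alpha)%:E)%E).
  apply: ereal_inf_lbound; exists F => //; split.
    move=> i; apply: (le_trans (Fd i)); rewrite lee_fin.
    by move: hk; rewrite ltr_pdivlMr// => /ltW; rewrite mulrC.
  move=> x Ex.
  have H l : exists w : k.-tuple bool, `|x ord0 l - cen w| <= lam ^+ k by apply: W_cover.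
  pose w : Wd := [ffun l => projT1 (cid (H l))].
  exists (enum_rank w) => //; exists w; split=> // l.
  by rewrite ffunE; exact: projT2 (cid (H l)).
have D0 i : (0 <= ediam (F i))%E by exact: ediam_ge0.
rewrite (@nneseries_split _ _ 0 #|Wd|); last by move=> i _; rewrite lee_fin powR_ge0.
rewrite [X in (_ + X)%E]eseries0 ?adde0; last first.
  move=> i Ni _; have -> : F i = set0.
    apply/seteqP; split=> // x [w [iw _]]; move: Ni.
    by rewrite iw add0n leqNgt ltn_ord.
  by rewrite ediam_set0 /= powR0// gt_eqF.
apply: (@le_trans _ _ (\sum_(0 <= i < 0 + #|Wd|) ((n%:R * 2 * lam ^+ k) `^ alpha)%:E)%E).
  apply: lee_sum => i _; rewrite lee_fin ge0_ler_powR ?nnegrE ?(ltW alpha0)//.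
  - exact: fine_ge0.
  - by rewrite mulr_ge0 ?ltW.
  - rewrite -lee_fin fineK//; rewrite ge0_fin_numE//.
    by apply: le_lt_trans (Fd i) _; exact: ltry.
have cW : #|Wd| = (2 ^ (n * k))%N.
  by rewrite card_ffun card_tuple card_bool card_ord -expnM mulnC.
rewrite sumEFin lee_fin sumr_const_nat subn0 add0n cW -[leLHS]mulr_natr natrX.
rewrite powRM ?(ltW nn) ?(ltW lk0)// lamX -mulrA.
by rewrite mulVf ?mulr1// expf_neq0.
Qed.

End CantorSet.

(** * Continuity, the product rule, and uniform limits *)

Section Calculus.
Variables (R : realType) (k : nat).
Implicit Types (f g : 'rV[R]_k -> R).

Lemma ucont_continuous f : ucont f -> continuous f.
Proof.
move=> uf x A /nbhs_ballP[e /= e0 eA]; have e2 : 0 < e / 2 by rewrite divr_gt0.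
have [d d0 H] := uf _ e2.
exists (fun i j => ball (x i j) d); first by move=> i j; exact: nbhsx_ballx.
move=> y xy; apply: eA; rewrite /ball /=; apply: (@le_lt_trans _ _ (e / 2)); last by lra.
by apply: H => i; exact: xy.
Qed.

Lemma continuous_borel f : continuous f -> borel_meas f.
Proof.
move=> cf B oB; apply: sub_sigma_algebra.
by move/continuousP: cf => /(_ _ oB).
Qed.

Lemma udiff_mul (j : 'I_k) f f' g g' : buc f -> buc f' -> buc g -> udiff j f f' -> udiff j g g' ->
  udiff j (fun x => f x * g x) (fun x => f' x * g x + f x * g' x).
Proof.
move=> bf bf' bg df dg e e0.
have [A A0 fA] := bu_bound bf; have [A' A'0 fA'] := bu_bound bf'.
have [B B0 gB] := bu_bound bg.
have e3 : 0 < e / 3 by lra.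
have [d1 d10 H1] := df _ (divr_gt0 e3 B0).
have [d2 d20 H2] := dg _ (divr_gt0 e3 A0).
have [d3 d30 H3] := bg.2 _ (divr_gt0 e3 A'0).
exists (Num.min d1 (Num.min d2 d3)); first by rewrite !lt_min d10 d20.
move=> x a; rewrite !lt_min => /and3P[a1 a2 a3].
set y := x + a *: evec R j.
have -> : f y * g y - f x * g x - a * (f' x * g x + f x * g' x) =
   (f y - f x - a * f' x) * g y + a * (f' x * (g y - g x)) + f x * (g y - g x - a * g' x) by ring.
have h1 : `|(f y - f x - a * f' x) * g y| <= e / 3 * `|a|.
  rewrite normrM; have -> : e / 3 * `|a| = (e / 3 / B * `|a|) * B by field; lra.
  by apply: ler_pM => //; exact: H1.
have h2 : `|a * (f' x * (g y - g x))| <= e / 3 * `|a|.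
  rewrite normrM mulrC; apply: ler_wpM2r => //; rewrite normrM.
  have -> : e / 3 = A' * (e / 3 / A') by field; lra.
  apply: ler_pM => //; apply: H3 => i; rewrite !mxE eqxx /= addrAC subrr add0r.
  by case: (i == j); rewrite ?mulr1// mulr0 normr0.
have h3 : `|f x * (g y - g x - a * g' x)| <= e / 3 * `|a|.
  rewrite normrM; have -> : e / 3 * `|a| = A * (e / 3 / A * `|a|) by field; lra.
  by apply: ler_pM => //; exact: H2.
apply: (le_trans (ler_normD _ _)); have := ler_normD ((f y - f x - a * f' x) * g y) (a * (f' x * (g y - g x))).
lra.
Qed.

Lemma bu_ulim (F : nat -> 'rV[R]_k -> R) f : (forall m, buc (F m)) ->
  (forall e, 0 < e -> exists m, forall x, `|f x - F m x| <= e) -> buc f.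
Proof.
move=> bF Ff; split.
  have [m Hm] := Ff 1 ltr01; have [[B FB] _] := bF m.
  exists (1 + B) => x; have := Hm x; have := FB x.
  have -> : f x = (f x - F m x) + F m x by ring.
  have := ler_normD (f x - F m x) (F m x); rewrite addrK; lra.
move=> e e0; have e3 : 0 < e / 3 by lra.
have [m Hm] := Ff _ e3; have [_ uF] := bF m; have [d d0 H] := uF _ e3.
exists d => // x y xy; have h1 := Hm x; have h2 := Hm y; have h3 := H x y xy.
rewrite distrC in h2.
have -> : f x - f y = (f x - F m x) + (F m x - F m y) + (F m y - f y) by ring.
apply: (le_trans (ler_normD _ _)).
have := ler_normD (f x - F m x) (F m x - F m y); lra.
Qed.

Lemma bu_sum (N : nat) (F : nat -> 'rV[R]_k -> R) : (forall m, buc (F m)) ->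
  buc (fun x => \sum_(0 <= m < N) F m x).
Proof.
move=> bF; elim: N => [|N IH].
  by under eq_fun do rewrite big_nil; exact: bu_cst.
have -> : (fun x => \sum_(0 <= m < N.+1) F m x) =
    fun x => 1 * (\sum_(0 <= m < N) F m x) + F N x.
  by apply/funext => x; rewrite big_nat_recr//= mul1r.
exact: bu_lin.
Qed.

(* The pointwise sum of a family with pairwise disjoint supports; [xget] picks
   the index of the only nonzero term, or 0 when all terms vanish. *)
Definition dsum (f : nat -> 'rV[R]_k -> R) (x : 'rV[R]_k) : R :=
  f (xget 0%N [set m | f m x != 0]) x.

(** * Measurability and integration of sums with disjoint supports *)

Section DisjointSum.
Variable f : nat -> 'rV[R]_k -> R.
Hypothesis fdisj : forall x i j, f i x != 0 -> f j x != 0 -> i = j.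

Lemma dsum_eq x m : f m x != 0 -> dsum f x = f m x.
Proof.
move=> fm; rewrite /dsum; case: xgetP => [i -> /= fi|/(_ m)//].
by rewrite (fdisj fi fm).
Qed.

Lemma dsum_eq0 x : (forall m, f m x = 0) -> dsum f x = 0.
Proof. by move=> f0; rewrite /dsum f0. Qed.

Lemma dsum_ex x : dsum f x != 0 -> exists2 m, f m x != 0 & dsum f x = f m x.
Proof. by move=> h; exists (xget 0%N [set m | f m x != 0]). Qed.

(** At most one term survives at x, so F commutes with the sum although it is not linear. It is used
    for the absolute value and for the positive and negative parts. *)
Lemma dsum_series (F : R -> R) x : F 0 = 0 -> (forall a, 0 <= F a) ->
  ((F (dsum f x))%:E = \sum_(0 <= m <oo) (F (f m x))%:E)%E.
Proof.
move=> F0 Fp; case: (pselect (exists m, f m x != 0)) => [[m fm]|nf]; last first.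
  have f0 m : f m x = 0 by apply/eqP/negPn/negP => h; apply: nf; exists m.
  rewrite dsum_eq0// F0; apply/esym; apply: eseries0 => m _ _.
  by rewrite f0 F0.
rewrite (dsum_eq fm) (@nneseriesD1 _ _ m)//; last by move=> *; rewrite lee_fin.
rewrite eseries0 ?adde0// => i _ /= im; apply: congr1.
have [->//|/fdisj/(_ fm) h] := eqVneq (f i x) 0.
by rewrite h eqxx in im.
Qed.

(** Away from the value 0 the preimage is a countable union of open sets, and the zero set is the
    complement of such a union; whether 0 belongs to B decides if it is added. *)
Lemma dsum_borel : (forall m, continuous (f m)) -> borel_meas (dsum f).
Proof.
move=> cf B oB.
set S := smallest _ _.
have [S0 SC SU] : sigma_algebra setT S by exact: smallest_sigma_algebra.
have So (A : set 'rV[R]_k) : open A -> S A by exact: sub_sigma_algebra.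
have SUn (A : nat -> set 'rV[R]_k) : (forall i, S (A i)) -> S (\bigcup_i A i) by exact: SU.
have SC' A : S A -> S (~` A) by move=> SA; rewrite -setTD; exact: SC.
have pre m A : open A -> open (f m @^-1` A) by move: (cf m) => /continuousP; apply.
have o0 : open [set y : R | y != 0] by exact: open_neq.
have n0 m : S [set x | f m x != 0] by apply: So; exact: (pre m _ o0).
have SB m : S [set x | f m x != 0 /\ B (f m x)].
  by apply: So; apply: (pre m ([set y | y != 0] `&` B)); exact: openI.
have E1 : dsum f @^-1` (B `\ 0) = \bigcup_m [set x | f m x != 0 /\ B (f m x)].
  apply/seteqP; split=> x /=.
    move=> [Bx /eqP nx]; have [m fm E] := dsum_ex nx.
    by exists m => //=; rewrite -E.
  move=> [m _ [fm Bm]]; rewrite (dsum_eq fm); split=> //; exact/eqP.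
have E2 : dsum f @^-1` [set 0] = ~` \bigcup_m [set x | f m x != 0].
  apply/seteqP; split=> x /=.
    by move=> x0 [m _ /= fm]; rewrite (dsum_eq fm) in x0; rewrite x0 eqxx in fm.
  move=> nf; apply: dsum_eq0 => m; apply/eqP/negPn/negP => h; apply: nf.
  by exists m.
have [B0|nB0] := pselect (B 0).
  have -> : dsum f @^-1` B = (dsum f @^-1` (B `\ 0)) `|` (dsum f @^-1` [set 0]).
    apply/seteqP; split=> x /=; last by move=> [[]//|->].
    by move=> Bx; have [->|nx] := pselect (dsum f x = 0); [right|left].
  rewrite E1 E2.
  have -> : forall C D : set 'rV[R]_k, C `|` D = \bigcup_i (if i is 0%N then C else D).
    move=> C D; apply/seteqP; split=> x.
      by case=> h; [exists 0%N|exists 1%N].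
    by case=> [[|i]] _ h; [left|right].
  apply: SUn => -[|i]; first exact: SU.
  by apply: SC'; exact: SU.
have -> : dsum f @^-1` B = dsum f @^-1` (B `\ 0).
  by apply/seteqP; split=> x /= => [Bx|[]//]; split=> // h; apply: nB0; rewrite -h.
by rewrite E1; exact: SUn.
Qed.

Variables (M A : R).
Hypotheses (cf : forall m, cc M (f m))
  (fA : forall N, \sum_(0 <= m < N) Jint (fun x => `|f m x|) <= A).

Lemma nnseries_fin (a : nat -> R) (C : R) : (forall m, 0 <= a m) ->
  (forall N, \sum_(0 <= m < N) a m <= C) ->
  cvgn (series a) /\ (\sum_(0 <= m <oo) (a m)%:E = (limn (series a))%:E)%E.
Proof.
move=> a0 aC.
have ca : cvgn (series a).
  apply: nondecreasing_is_cvgn; first by apply: nondecreasing_series => m _ _.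
  by exists C => _ /= [N _ <-]; exact: aC.
split=> //; rewrite -EFin_lim//.
have -> : EFin \o series a = fun N => (\sum_(0 <= m < N) (a m)%:E)%E.
  by apply/funext => N; rewrite /= /series /= sumEFin.
by [].
Qed.

Lemma nnseries_lt (a : nat -> R) (C : R) : (forall m, 0 <= a m) ->
  (forall N, \sum_(0 <= m < N) a m <= C) -> (\sum_(0 <= m <oo) (a m)%:E < +oo)%E.
Proof. by move=> a0 aC; rewrite (nnseries_fin a0 aC).2 ltry. Qed.

Lemma iint_dsum_fin : (iint (fun x => `|dsum f x|%:E) < +oo)%E.
Proof.
have -> : (fun x => `|dsum f x|%:E) = (fun x => \sum_(0 <= m <oo) `|f m x|%:E)%E.
  by apply/funext => x; apply: (dsum_series (F := fun a => `|a|)) => //; rewrite normr0.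
rewrite (iint_series (M := M))//; last by move=> m; exact: cc_abs.
apply: nnseries_lt fA => m; exact: (Jint_ge0 (cc_abs (cf m))).
Qed.

Lemma Jint_le f1 f2 : cc M f1 -> cc M f2 -> (forall x, f1 x <= f2 x) -> Jint f1 <= Jint f2.
Proof.
move=> c1 c2 f12; rewrite -subr_ge0.
have := Jint_ge0 (cc_lin (-1) c1 c2); rewrite (Jint_lin _ c1 c2) mulN1r addrC.
by apply=> x; rewrite mulN1r addrC subr_ge0.
Qed.

Lemma iint_dsum_part (F : R -> R) : F 0 = 0 -> (forall a, 0 <= F a <= `|a|) ->
  (forall a b, `|F a - F b| <= `|a - b|) ->
  cvgn (series (fun m => Jint (fun x => F (f m x)))) /\
  (iint (fun x => (F (dsum f x))%:E) = (limn (series (fun m => Jint (fun x => F (f m x)))))%:E)%E.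
Proof.
move=> F0 Fp Fl.
have cF m : cc M (fun x => F (f m x)) by exact: cc_lip.
have F0' a : 0 <= F a by case/andP: (Fp a).
have [c E] : cvgn (series (fun m => Jint (fun x => F (f m x)))) /\
    (\sum_(0 <= m <oo) (Jint (fun x => F (f m x)))%:E =
     (limn (series (fun m => Jint (fun x => F (f m x)))))%:E)%E.
  apply: (@nnseries_fin _ A) => [m|N]; first exact: (Jint_ge0 (cF m)).
  apply: le_trans (fA N); apply: ler_sum => m _; apply: Jint_le => //.
    exact: cc_abs.
  by move=> x; case/andP: (Fp (f m x)).
split=> //; rewrite -E.
have -> : (fun x => (F (dsum f x))%:E) = (fun x => \sum_(0 <= m <oo) (F (f m x))%:E)%E.
  by apply/funext => x; exact: dsum_series.
exact: (iint_series (M := M)).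
Qed.

(** The positive and negative parts are nonnegative disjoint sums, so [iint_series] integrates each
    termwise; the bound A makes both finite, and they can be subtracted. *)
Lemma sint_dsum : cvgn (series (fun m => Jint (f m))) /\
  sint (dsum f) = (limn (series (fun m => Jint (f m))))%:E.
Proof.
have m0 (a : R) : 0 <= Num.max a 0 <= `|a|.
  by case: (leP a 0) => h; rewrite ?lexx ?normr_ge0// ler_norm andbT ltW.
have [c1 E1] := iint_dsum_part (F := fun a => Num.max a 0) (maxxx 0) m0 (@lip_max0 R).
have m1 (a : R) : 0 <= Num.max (- a) 0 <= `|a| by rewrite -normrN.
have l1 (a b : R) : `|Num.max (- a) 0 - Num.max (- b) 0| <= `|a - b|.
  by apply: le_trans (lip_max0 _ _) _; rewrite -opprD normrN.
have m2 : Num.max (- 0) 0 = 0 :> R by rewrite oppr0 maxxx.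
have [c2 E2] := iint_dsum_part (F := fun a => Num.max (- a) 0) m2 m1 l1.
have H : series (fun m => Jint (f m)) =
   (series (fun m => Jint (fun x => Num.max (f m x) 0))
   - series (fun m => Jint (fun x => Num.max (- f m x) 0))).
  apply/funext => N; rewrite /series /= !fctE -sumrB; apply: eq_bigr => m _.
  have cN : cc M (fun x => - f m x).
    by under eq_fun do rewrite -mulN1r; exact: cc_scale.
  rewrite addrC -mulN1r -(Jint_lin _ (cc_max0 cN) (cc_max0 (cf m))).
  by congr Jint; apply/funext => x; case: (leP (f m x) 0); case: (leP (- f m x) 0); lra.
rewrite /sint E1 E2 -EFinB H; split; first exact: is_cvgB.
by rewrite limB.
Qed.

End DisjointSum.
End Calculus.

(** * Test functions have uniform difference quotients *)

Section TestFunctions.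
Variables (R : realType) (k : nat).

Lemma compact_box (K : set 'rV[R]_k) : compact K ->
  exists2 M : R, 0 <= M & forall x, K x -> forall i, `|x ord0 i| <= M.
Proof.
move=> /compact_bounded[M0 [_ H]]; exists (`|M0| + 1); first by rewrite addr_ge0.
move=> x Kx i; have M1 : M0 < `|M0| + 1 by rewrite (le_lt_trans (ler_norm _))// ltrDl.
apply: le_trans (H _ M1 x Kx).
by rewrite [leRHS]/Num.norm /= mx_normrE; apply: (le_bigmax _ _ (ord0, i)).
Qed.

Lemma box_compact (M : R) : compact [set x : 'rV[R]_k | forall i, `|x ord0 i| <= M].
Proof.
have -> : [set x : 'rV[R]_k | forall i, `|x ord0 i| <= M] =
   [set x : 'rV[R]_k | forall i, `[- M, M]%classic (x ord0 i)].
  by apply/seteqP; split=> x /= h i; have := h i; rewrite in_itv /= ler_norml.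
by apply: (@rV_compact R k (fun _ => `[- M, M]%classic)) => i; exact: segment_compact.
Qed.

(** Heine-Cantor on the box. The predicate P lets y range over the whole space, so pairs with only
    one point in the box are covered; pairs with none have both values 0. *)
Lemma continuous_cc (M : R) (f : 'rV[R]_k -> R) : 0 <= M -> continuous f ->
  (forall (x : 'rV[R]_k) i, M < `|x ord0 i| -> f x = 0) -> cc M f.
Proof.
move=> M0 cf f0; split=> //; split.
  have /compact_bounded[B [_ H]] : compact (f @` [set x : 'rV[R]_k | forall i, `|x ord0 i| <= M]).
    apply: continuous_compact; last exact: box_compact.
    exact: continuous_subspaceT.
  exists (`|B| + 1) => x.
  have B1 : B < `|B| + 1 by rewrite (le_lt_trans (ler_norm _))// ltrDl.
  have [h|] := pselect (forall i, `|x ord0 i| <= M); first by apply: (H _ B1); exists x.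
  by move=> /existsNP[i /negP]; rewrite -ltNge => /f0 ->; rewrite normr0 addr_ge0.
move=> e e0; have e2 : 0 < e / 2 by lra.
pose K := [set x : 'rV[R]_k | forall i, `|x ord0 i| <= M].
pose P (d : R) (x : 'rV[R]_k) := forall y : 'rV[R]_k,
  (forall i, `|x ord0 i - y ord0 i| < d) -> `|f x - f y| <= e.
have H : \forall d \near (0 : R)^'+, K `<=` P d.
  have /compact_near_coveringP := @box_compact M.
  apply=> x _.
  have : nbhs x (f @^-1` ball (f x) (e / 2)) by apply: cf; exact: nbhsx_ballx.
  move=> /nbhs_ballP[r /= r0 rf].
  have r2 : 0 < r / 2 by lra.
  exists (ball x (r / 2), [set d : R | d < r / 2]); first split.
  - exact: nbhsx_ballx.
  - exact: nbhs_right_lt.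
  move=> [x' d] /= [xx' dr] y x'y.
  have h1 : `|f x - f x'| < e / 2.
    by apply: rf; apply: le_ball xx'; lra.
  have h2 : `|f x - f y| < e / 2.
    apply: rf; split=> // i j; rewrite [i]ord1 /ball /=.
    have := xx'.2 ord0 j; have := x'y j; rewrite /ball /= => ? ?.
    have := ler_distD (x' ord0 j) (x ord0 j) (y ord0 j); lra.
  rewrite distrC in h1; have := ler_distD (f x) (f x') (f y); lra.
have [d [d0 Hd]] : exists d : R, 0 < d /\ K `<=` P d.
  near (0 : R)^'+ => d; exists d; split; last by near: d.
  by near: d; exact: nbhs_right_gt.
exists d => // x y xy.
have out z : ~ K z -> f z = 0.
  by move=> /existsNP[i /negP]; rewrite -ltNge => /f0.
have [Kx|/out fx] := pselect (K x); first exact: Hd.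
have [Ky|/out fy] := pselect (K y); last by rewrite fx fy subrr normr0 ltW.
by rewrite distrC; apply: (Hd y Ky) => i; rewrite distrC.
Unshelve. all: by end_near. Qed.

Variables (j : 'I_k) (psi : 'rV[R]_k -> R).
Hypothesis tpsi : test_fun psi.

Lemma test_line (x : 'rV[R]_k) (t : R) :
  is_derive t 1 (fun t : R => psi (x + t *: evec R j)) (pderiv j psi (x + t *: evec R j)).
Proof.
have dpsi := diff_derivable (v := evec R j) (tpsi.1 [::] (x + t *: evec R j)).
have E : (fun h : R => h^-1 *: (((fun t : R => psi (x + t *: evec R j)) \o shift t) (h *: (1 : R))
            - psi (x + t *: evec R j))) =
         (fun h : R => h^-1 *: ((psi \o shift (x + t *: evec R j)) (h *: evec R j)
            - psi (x + t *: evec R j))).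
  apply/funext => h /=; congr (_ *: (psi _ - _)).
  have -> : h%:A = h :> R by rewrite /GRing.scale /= mulr1.
  by rewrite scalerDl addrCA.
apply: DeriveDef; first by rewrite /derivable E.
by rewrite /pderiv /derive E.
Qed.

(** The mean value theorem along the j-th direction turns the increment into a derivative at an
    intermediate point, and uniform continuity of the derivative makes the error independent of
    x. *)
Lemma test_cc : exists M : R, [/\ cc M psi, cc M (pderiv j psi) & udiff j psi (pderiv j psi)].
Proof.
have [dp [K [cK K0]]] := tpsi; have [M M0 HM] := compact_box cK.
have p0 (x : 'rV[R]_k) i : M < `|x ord0 i| -> psi x = 0.
  by move=> h; apply: K0 => /HM/(_ i); rewrite leNgt h.
have c0 : cc M psi.
  by apply: continuous_cc => // x; apply: differentiable_continuous; exact: (dp [::]).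
have c1 : cc M (pderiv j psi).
  apply: continuous_cc => //.
    by move=> x; apply: differentiable_continuous; exact: (dp [:: j]).
  move=> x i xi; rewrite /pderiv.
  rewrite (@near_eq_derive R _ _ psi (cst 0)) ?derive_cst//.
  apply/nbhs_ballP; exists (`|x ord0 i| - M); first by rewrite /= subr_gt0.
  move=> y xy; apply: (p0 y i); have := xy.2 ord0 i; rewrite /ball /= => h.
  have := lerB_dist (x ord0 i) (y ord0 i); lra.
exists M; split=> // e e0; have [_ _ [_ uc]] := c1; have [d d0 Hd] := uc e e0.
exists d => // x a ad.
pose phi t := psi (x + t *: evec R j); pose dphi t := pderiv j psi (x + t *: evec R j).
have dphiP (t : R) : is_derive t 1 phi (dphi t) := test_line x t.
have cphi : continuous phi.
  by move=> t; apply: differentiable_continuous; apply/derivable1_diffP.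
have close c : `|c| <= `|a| -> `|dphi c - dphi 0| <= e.
  move=> ca; apply: Hd => i; rewrite !mxE eqxx /= mul0r addr0 addrAC subrr add0r.
  apply: le_lt_trans ad; apply: le_trans ca.
  by case: (i == j); rewrite ?mulr1// mulr0 normr0.
have phi0 : phi 0 = psi x by rewrite /phi scale0r addr0.
have dphi0 : dphi 0 = pderiv j psi x by rewrite /dphi scale0r addr0.
rewrite -phi0 -dphi0 -/(phi a).
suff [c ca E] : exists2 c, `|c| <= `|a| & phi a - phi 0 = dphi c * a.
  rewrite E (mulrC a) -mulrBl normrM; apply: ler_wpM2r => //; exact: close.
have [a0|a0|->] := ltgtP a 0; last first.
- by exists 0; rewrite ?mulr0 ?subrr.
- have [c] := MVT a0 (fun t _ => dphiP t) (continuous_subspaceT cphi).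
  rewrite in_itv /= subr0 => /andP[c0' ca] ->; exists c => //.
  by rewrite !gtr0_norm// ltW.
- have [c] := MVT a0 (fun t _ => dphiP t) (continuous_subspaceT cphi).
  rewrite in_itv /= sub0r => /andP[ac c0'] E; exists c.
    by rewrite !ltr0_norm// lerN2 ltW.
  by rewrite -opprB E mulrN opprK.
Qed.

End TestFunctions.

Lemma Jint_sum (R : realType) k (M : R) (F : nat -> 'rV[R]_k -> R) N : (forall m, cc M (F m)) ->
  cc M (fun x => \sum_(0 <= m < N) F m x) /\
  Jint (fun x => \sum_(0 <= m < N) F m x) = \sum_(0 <= m < N) Jint (F m).
Proof.
move=> cF; have c0 : cc M (fun _ : 'rV[R]_k => 0 : R).
  by have [? _ _] := cF 0%N; split=> //; exact: bu_cst.
elim: N => [|N [IHc IH]].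
  have -> : (fun x => \sum_(0 <= m < 0) F m x) = fun=> 0.
    by apply/funext => x; rewrite big_nil.
  rewrite big_nil; split=> //.
  rewrite -[RHS](mul0r (Jint (fun _ : 'rV[R]_k => 0 : R))) -(JintZ 0 c0).
  by congr Jint; apply/funext => x; rewrite mulr0.
have E : (fun x => \sum_(0 <= m < N.+1) F m x) =
    fun x => 1 * (\sum_(0 <= m < N) F m x) + F N x.
  by apply/funext => x; rewrite big_nat_recr//= mul1r.
rewrite E; split; first exact: cc_lin.
by rewrite (Jint_lin _ IHc (cF N)) mul1r IH big_nat_recr.
Qed.

Lemma geometric_partial (R : realType) (q : R) N : 0 <= q -> q < 1 ->
  \sum_(0 <= k < N) q ^+ k <= (1 - q)^-1.
Proof.
move=> q0 q1; have p0 : 0 < 1 - q by lra.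
rewrite -[leRHS]mul1r ler_pdivlMr// mulrC big_mkord.
have := subrX1 q N.
have : 0 <= q ^+ N by exact: exprn_ge0.
lra.
Qed.

(** * The map u, its weak gradient and its values on E *)

Section Map.
Variables (R : realType) (lam r A p : R) (n : nat) (s : nat -> R).
Hypotheses (lam0 : 0 < lam) (lam2 : lam < 2^-1) (r0 : 0 < r) (r2 : r < 2^-1).
Hypotheses (gs : geo r s) (n0 : (0 < n)%N) (p1 : 1 <= p).
(** Up to constants, the gradient of generation k has size s_k lam^-k and lives on 2^(k n) cubes of
    side lam^k. *)
Hypothesis energy : forall N,
  \sum_(0 <= k < N) (s k * lam ^- k) `^ p * (2 * lam) ^+ (k * n) <= A.

Local Notation rh := (rho lam).
Local Notation rh' := (rho' lam).

(** Only coordinate i carries the sign, so near the Cantor set [tau k i] is the sign of digit k of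
    coordinate i. *)
Definition sign_at (i l : 'I_n) : R := if l == i then -1 else 1.

Lemma sg_le1 i l : `|sign_at i l| <= 1.
Proof. by rewrite /sign_at; case: ifP; rewrite ?normrN normr1. Qed.

Lemma rh_supp : supp lam 0 rh. Proof. exact: cu1_supp0 (rho_cu1 lam0 lam2). Qed.
Lemma rh'_supp : supp lam 0 rh'. Proof. exact: cu1_supp0 (rho'_cu1 lam0 lam2). Qed.

Lemma rh_le1 t : `|rh t| <= 1.
Proof. by have /andP[h1 h2] := rho_01 lam0 lam2 t; rewrite ger0_norm. Qed.

Definition tau (k : nat) (i : 'I_n) (x : 'rV[R]_n) : R :=
  \prod_l gen lam k (sign_at i l) rh (x ord0 l).

Definition rho_or_rho' (j l : 'I_n) : R -> R := if l == j then rh' else rh.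

Definition dtau (k : nat) (i j : 'I_n) (x : 'rV[R]_n) : R :=
  lam ^- k.+1 * \prod_l gen lam k (sign_at i l) (rho_or_rho' j l) (x ord0 l).

(** A majorant for generation k of the gradient: it is 1 wherever that gradient is nonzero, and
    [Jint_chi] computes its integral exactly. *)
Definition chi (k : nat) (x : 'rV[R]_n) : R :=
  \prod_(l < n) iter k (transfer lam 1) rh (x ord0 l).

Lemma rj_cu1 j l : cu1 1 (rho_or_rho' j l).
Proof. by rewrite /rho_or_rho'; case: ifP => _; [exact: rho'_cu1|exact: rho_cu1]. Qed.

Lemma rj_supp j l : supp lam 0 (rho_or_rho' j l).
Proof. exact: cu1_supp0 (rj_cu1 j l). Qed.

Lemma tau_cc k i : cc 1 (tau k i).
Proof.
apply: (cc_prod (f := fun l => gen lam k (sign_at i l) rh)) => // l.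
by apply: Q_cu1 => //; exact: rho_cu1.
Qed.

Lemma dtau_cc k i j : cc 1 (dtau k i j).
Proof.
apply: cc_scale; apply: (cc_prod (f := fun l => gen lam k (sign_at i l) (rho_or_rho' j l))) => // l.
by apply: Q_cu1 => //; exact: rj_cu1.
Qed.

Lemma chi_cc k : cc 1 (chi k).
Proof.
apply: (cc_prod (f := fun l => iter k (transfer lam 1) rh)) => // l.
by apply: iter_Tr_cu1 => //; exact: rho_cu1.
Qed.

Lemma Jint_chi k : Jint (chi k) = (2 * lam) ^+ (k * n) * int1 rh ^+ n.
Proof.
rewrite (Jint_prod (M := 1) (f := fun l => iter k (transfer lam 1) rh))//; last first.
  by move=> l; apply: iter_Tr_cu1 => //; exact: rho_cu1.
rewrite prodr_const card_ord (I1_iter_Tr lam0 lam2); last exact: rho_cu1.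
by rewrite exprMn exprM.
Qed.

Lemma iter_ge0 k t : 0 <= iter k (transfer lam 1) rh t.
Proof.
elim: k t => [|k IH] t /=; first by have /andP[] := rho_01 lam0 lam2 t.
by rewrite /transfer mul1r addr_ge0.
Qed.

Lemma chi_ge0 k x : 0 <= chi k x.
Proof. by apply: prodr_ge0 => l _; exact: iter_ge0. Qed.

Lemma prod_Q_le1 (P : pred 'I_n) k i (x : 'rV[R]_n) :
  `|\prod_(l | P l) gen lam k (sign_at i l) rh (x ord0 l)| <= 1.
Proof.
rewrite normr_prod; apply: prodr_ile1 => l _; rewrite normr_ge0 /=.
by apply: (@Q_bound R lam lam0 lam2 _ _ _ _ rh_supp); [exact: sg_le1|exact: rh_le1].
Qed.

Lemma tau_le1 k i x : `|tau k i x| <= 1.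
Proof. exact: prod_Q_le1. Qed.

Lemma tau_udiff k i j : udiff j (tau k i) (dtau k i j).
Proof.
move=> e e0; have [d d0 H] := Q_ud1 lam0 k (sign_at i j) (rho_ud1 lam0 lam2) e0.
exists d => // x a ad.
rewrite /tau /dtau !(bigD1 j (P := predT))//=.
set y := x + a *: evec R j.
have yl l : l != j -> y ord0 l = x ord0 l.
  by move=> lj; rewrite !mxE (negPf lj) andbF mulr0 addr0.
have yj : y ord0 j = x ord0 j + a by rewrite !mxE !eqxx mulr1.
pose P := \prod_(l | l != j) gen lam k (sign_at i l) rh (x ord0 l).
have -> : \prod_(l | l != j) gen lam k (sign_at i l) rh (y ord0 l) = P.
  by apply: eq_bigr => l lj; rewrite yl.
have -> : \prod_(l | l != j) gen lam k (sign_at i l) (rho_or_rho' j l) (x ord0 l) = P.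
  by apply: eq_bigr => l lj; rewrite /rho_or_rho' (negPf lj).
rewrite -/P yj {1}/rho_or_rho' eqxx.
have h := H (x ord0 j) a ad.
set X := gen _ _ _ _ (_ + a) in h *; set Y := gen _ _ _ rh _ in h *; set Z := gen _ _ _ rh' _ in h *.
have -> : X * P - Y * P - a * (lam ^- k.+1 * (Z * P)) = (X - Y - a * (lam ^- k.+1 * Z)) * P by ring.
rewrite normrM -[leRHS]mulr1; apply: ler_pM => //; exact: prod_Q_le1.
Qed.

Lemma prod_Q_neq0 k i (f : 'I_n -> R -> R) (x : 'rV[R]_n) l :
  \prod_l gen lam k (sign_at i l) (f l) (x ord0 l) != 0 -> gen lam k (sign_at i l) (f l) (x ord0 l) != 0.
Proof. by move/prodf_neq0 => /(_ l isT). Qed.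

Lemma dtau_W k i j x : dtau k i j x != 0 -> forall l, W lam k.+1 (x ord0 l).
Proof.
rewrite mulf_eq0 negb_or => /andP[_ h] l; have {}h := prod_Q_neq0 l h.
apply: contrapT => nW; move/eqP: h; apply.
by apply: (Q_supp _ (rj_supp j l)).
Qed.

(* Different generations of gradients live on disjoint sets: [rho'] vanishes
   on the supports of all later generations. *)
Lemma dtau_disj i j x k m : dtau k i j x != 0 -> dtau m i j x != 0 -> k = m.
Proof.
wlog km : k m / (k < m)%N.
  move=> H hk hm; have [km|mk|//] := ltngtP k m; first exact: H.
  by apply/esym; exact: H.
move=> hk /dtau_W/(_ j) Wm; exfalso; move: hk.
rewrite mulf_eq0 negb_or => /andP[_ h]; have := prod_Q_neq0 j h.
rewrite /rho_or_rho' eqxx (Q_vanish lam0 lam2 _ rh'_supp) ?eqxx//.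
  by move=> t /(W_half lam0 lam2) /(rho_near lam2)[].
by apply: (W_le lam0 lam2 _ Wm).
Qed.

(** Where [dtau k i j] is nonzero all coordinates lie in [W k.+1], hence [chi k] is 1. C absorbs the
    bound on the profiles and the one factor lam^-1 by which the chain rule exceeds lam^-k. *)
Lemma dtau_chi : exists2 C, 0 <= C & forall k i j x,
  `|dtau k i j x| <= lam ^- k * C * chi k x.
Proof.
have [_ _ [B hB] _] := rho'_cu1 lam0 lam2.
pose B1 := Num.max 1 B.
have B11 : 1 <= B1 by rewrite le_max lexx.
have BB : B <= B1 by rewrite le_max lexx orbT.
have l0 := lam0.
exists (lam^-1 * B1 ^+ n); first by rewrite mulr_ge0 ?invr_ge0 ?exprn_ge0//; lra.
move=> k i j x; have [->|nz] := eqVneq (dtau k i j x) 0.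
  rewrite normr0 !mulr_ge0 ?chi_ge0 ?invr_ge0 ?exprn_ge0//; lra.
have -> : chi k x = 1.
  rewrite /chi big1// => l _.
  apply: (iter_Tr_one lam0 lam2 (k := 1)) => //; first exact: rh_supp.
    by move=> t /(W_half lam0 lam2) /(rho_near lam2)[].
  by rewrite addn1; exact: dtau_W nz l.
rewrite mulr1 /dtau normrM mulrA -invfM -exprSr.
rewrite gtr0_norm ?invr_gt0 ?exprn_gt0//; apply: ler_wpM2l.
  by rewrite invr_ge0 exprn_ge0// ltW.
rewrite normr_prod.
have -> : B1 ^+ n = \prod_(l < n) B1 by rewrite prodr_const card_ord.
apply: ler_prod => l _; rewrite normr_ge0 /=.
apply: (@Q_bound R lam lam0 lam2 _ _ _ _ (rj_supp j l)); first exact: sg_le1.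
move=> t; rewrite /rho_or_rho'; case: ifP => _; first exact: le_trans (hB t) BB.
exact: le_trans (rh_le1 t) B11.
Qed.

Definition ucomp (i : 'I_n) (x : 'rV[R]_n) : R := ssum s (fun k => tau k i x).
Definition umap (x : 'rV[R]_n) : 'rV[R]_n := \row_i ucomp i x.
Definition grad_gen (i j : 'I_n) (k : nat) (x : 'rV[R]_n) : R := s k * dtau k i j x.
Definition grad (i j : 'I_n) : 'rV[R]_n -> R := dsum (grad_gen i j).

Lemma s_ge0 k : 0 <= s k. Proof. exact: gs.1. Qed.

Lemma uu_tail i x N :
  `|ucomp i x - \sum_(0 <= k < N) tau k i x * s k| <= s 0%N * r ^+ N / (1 - r).
Proof. by apply: ssum_tail => // k; exact: tau_le1. Qed.

Lemma tail_small (c e : R) : 0 < e -> \forall N \near \oo, c * (s 0%N * r ^+ N / (1 - r)) <= e.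
Proof.
move=> e0; have rr := r2; have rr0 := r0.
have h : (fun N => c * (s 0%N * r ^+ N / (1 - r))) @ \oo --> (0 : R).
  have -> : (fun N => c * (s 0%N * r ^+ N / (1 - r))) = (fun N => (c * s 0%N / (1 - r)) * r ^+ N).
    by apply/funext => N; ring.
  rewrite -[X in _ --> X](mulr0 (c * s 0%N / (1 - r))).
  apply: cvgM; first exact: cvg_cst.
  by apply: cvg_expr; rewrite gtr0_norm//; lra.
have /cvgrPdist_le/(_ e e0) := h; apply: filterS => N /=.
by rewrite sub0r normrN; apply: le_trans; exact: ler_norm.
Qed.

Lemma uu_cc i : cc 1 (ucomp i).
Proof.
split=> //.
  move=> x l xl; have t0 k : tau k i x = 0 by have [_ h _] := tau_cc k i; exact: h xl.
  rewrite /ucomp /ssum.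
  have -> : (fun k => tau k i x * s k) = fun=> 0 by apply/funext => k; rewrite t0 mul0r.
  have -> : series (fun=> 0 : R) = fun=> 0 by apply/funext => N; rewrite /series /= big1.
  exact: lim_cst.
apply: (bu_ulim (F := fun N x => \sum_(0 <= k < N) tau k i x * s k)).
  move=> N; apply: (bu_sum N (F := fun k x => tau k i x * s k)) => k.
  by apply: bu_mul; [case: (tau_cc k i)|exact: bu_cst].
move=> e e0; have [N _ HN] := tail_small 1 e0; exists N => x.
by apply: le_trans (uu_tail i x N) _; have := HN N (leqnn N); rewrite /= mul1r.
Qed.

Lemma umap_continuous : continuous umap.
Proof.
move=> x B [P Px PB].
have H : \forall y \near x, forall l : 'I_n, P ord0 l (ucomp l y).
  apply: (filter_forall (F := nbhs x) (f := fun l => [set y | P ord0 l (ucomp l y)])) => l.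
  have [_ _ [_ uc]] := uu_cc l.
  apply: (ucont_continuous uc); have := Px ord0 l; by rewrite mxE.
apply: filterS H => y Hy; apply: PB => i l; rewrite [i]ord1 mxE; exact: Hy.
Qed.

Lemma fk_cc i j k : cc 1 (grad_gen i j k).
Proof. by apply: cc_scale; exact: dtau_cc. Qed.

Lemma fk_dtau i j k x : grad_gen i j k x != 0 -> dtau k i j x != 0.
Proof. by rewrite mulf_eq0 negb_or => /andP[]. Qed.

Lemma fk_disj i j x k m : grad_gen i j k x != 0 -> grad_gen i j m x != 0 -> k = m.
Proof. by move=> /fk_dtau h /fk_dtau; exact: dtau_disj. Qed.

Lemma le1DpowR (t : R) : 0 <= t -> t <= 1 + t `^ p.
Proof.
move=> t0; have [t1|t1] := leP t 1; first by rewrite (le_trans t1)// lerDl powR_ge0.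
apply: (@le_trans _ _ (t `^ p)); last by rewrite lerDr.
by rewrite -{1}[t]powRr1// ler_powR// ltW.
Qed.

(** The p-energy controls the L^1 norms through t <= 1 + t^p: the constant 1 contributes the volumes
    (2 lam)^(k n) <= (2 lam)^k, summable since lam < 1/2. *)
Lemma Jint_fk_sum : exists D, forall i j N,
  \sum_(0 <= k < N) Jint (fun x => `|grad_gen i j k x|) <= D.
Proof.
have [C C0 HC] := dtau_chi; have l0 := lam0; have l2 := lam2.
pose I := `|int1 rh| ^+ n.
have I0 : 0 <= I by exact: exprn_ge0.
exists (C * I * ((1 - 2 * lam)^-1 + A)) => i j N.
have H k : Jint (fun x => `|grad_gen i j k x|) <=
    C * I * ((2 * lam) ^+ k + (s k * lam ^- k) `^ p * (2 * lam) ^+ (k * n)).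
  have t0 : 0 <= s k * lam ^- k by rewrite mulr_ge0 ?s_ge0// invr_ge0 exprn_ge0// ltW.
  apply: (@le_trans _ _ (Jint (fun x => (s k * lam ^- k * C) * chi k x))).
    apply: (@Jint_le _ _ 1); [exact: cc_abs (fk_cc i j k)|exact: cc_scale (chi_cc k)|].
    move=> x; rewrite /grad_gen normrM (ger0_norm (s_ge0 k)) -!mulrA.
    by apply: ler_wpM2l; rewrite ?s_ge0// mulrA; exact: HC.
  rewrite (JintZ _ (chi_cc k)) Jint_chi.
  have q0 : 0 <= (2 * lam) ^+ (k * n) by rewrite exprn_ge0//; lra.
  apply: (@le_trans _ _ (s k * lam ^- k * C * ((2 * lam) ^+ (k * n) * I))).
    apply: ler_wpM2l; first exact: mulr_ge0.
    by rewrite ler_wpM2l// /I -normrX ler_norm.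
  have -> : s k * lam ^- k * C * ((2 * lam) ^+ (k * n) * I) =
     C * I * ((s k * lam ^- k) * (2 * lam) ^+ (k * n)) by ring.
  apply: ler_wpM2l; first exact: mulr_ge0.
  apply: (@le_trans _ _ ((1 + (s k * lam ^- k) `^ p) * (2 * lam) ^+ (k * n))).
    by apply: ler_wpM2r => //; exact: le1DpowR.
  rewrite mulrDl mul1r lerD2r ler_wiXn2l//; [lra|lra|].
  by rewrite leq_pmulr.
apply: (@le_trans _ _ (\sum_(0 <= k < N)
   C * I * ((2 * lam) ^+ k + (s k * lam ^- k) `^ p * (2 * lam) ^+ (k * n)))).
  by apply: ler_sum => k _; exact: H.
rewrite -mulr_sumr; apply: ler_wpM2l; first exact: mulr_ge0.
rewrite big_split /=; apply: lerD => //; apply: geometric_partial; lra.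
Qed.

Lemma gg_loc_int i j : loc_int (grad i j).
Proof.
split.
  apply: dsum_borel; first exact: fk_disj.
  by move=> m; apply: ucont_continuous; have [_ _ []] := fk_cc i j m.
move=> K _; have [D HD] := Jint_fk_sum.
apply: le_lt_trans (iint_dsum_fin (@fk_disj i j) (fk_cc i j) (HD i j)).
apply: iint_le => x; rewrite lee_fin; first by rewrite mulr_ge0// indicE.
by rewrite -[leRHS]mulr1; apply: ler_wpM2l.
Qed.

Lemma uu_loc_int i : loc_int (ucomp i).
Proof.
have [_ _ [_ uc]] := uu_cc i; split.
  by apply: continuous_borel; exact: ucont_continuous.
move=> K _; apply: (@le_lt_trans _ _ (iint (fun x => `|ucomp i x|%:E))).
  apply: iint_le => x; rewrite lee_fin; first by rewrite mulr_ge0// indicE.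
  by rewrite -[leRHS]mulr1; apply: ler_wpM2l.
by rewrite (iint_Jint (cc_abs (uu_cc i))) ltry.
Qed.

(** Integration by parts holds generation by generation. On the side of u the partial sums converge
    uniformly; on the side of the gradient [sint_dsum] sums the disjoint generations. *)
Lemma uu_weak i j : weak_pderiv j (ucomp i) (grad i j).
Proof.
split; first exact: gg_loc_int.
move=> psi tpsi; have [M [c0 c1 dpsi]] := test_cc j tpsi.
have [_ _ b0] := c0; have [_ _ b1] := c1.
have [B B0 HB] := bu_bound b0; have [B' B'0 HB'] := bu_bound b1.
pose h k (x : 'rV[R]_n) := grad_gen i j k x * psi x.
have hcc k : cc 1 (h k) by exact: cc_mul (fk_cc i j k) b0.
have hf k x : h k x != 0 -> grad_gen i j k x != 0.
  by apply: contra_neq => z; rewrite /h z mul0r.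
have hd x k m : h k x != 0 -> h m x != 0 -> k = m.
  by move=> /hf h1 /hf; exact: fk_disj.
have E : (fun x => grad i j x * psi x) = dsum h.
  apply/funext => x; case: (pselect (exists m, h m x != 0)) => [[m hm]|nh].
    rewrite (dsum_eq hd hm) /grad; congr (_ * _); apply: dsum_eq; first exact: fk_disj.
    exact: hf.
  have h0 m : h m x = 0 by apply/eqP/negPn/negP => hm; apply: nh; exists m.
  by rewrite (dsum_eq0 h0); exact: h0.
have [D HD] := Jint_fk_sum.
have HDB N : \sum_(0 <= k < N) Jint (fun x => `|h k x|) <= B * D.
  apply: (@le_trans _ _ (B * \sum_(0 <= k < N) Jint (fun x => `|grad_gen i j k x|))); last first.
    by apply: ler_wpM2l; [exact: ltW|exact: HD].
  rewrite mulr_sumr; apply: ler_sum => k _; have ca := cc_abs (fk_cc i j k).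
  rewrite -(JintZ _ ca); apply: (@Jint_le _ _ 1); [exact: cc_abs|exact: cc_scale|].
  by move=> x; rewrite normrM mulrC; apply: ler_wpM2r.
have [_ ->] : cvgn (series (fun m => Jint (h m))) /\
    sint (fun x => grad i j x * psi x) = (limn (series (fun m => Jint (h m))))%:E.
  by rewrite E; exact: (sint_dsum hd hcc HDB).
have cu : cc 1 (fun x => ucomp i x * pderiv j psi x) by exact: cc_mul (uu_cc i) b1.
rewrite (sint_Jint cu) -EFinN; congr EFin; apply/eqP; rewrite -eqr_oppLR; apply/eqP.
apply/esym/cvg_lim => //.
have ct k : cc 1 (fun x => tau k i x * pderiv j psi x) by exact: cc_mul (tau_cc k i) b1.
have cd k : cc 1 (fun x => dtau k i j x * psi x) by exact: cc_mul (dtau_cc k i j) b0.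
(* The product [tau k i] times psi has compact support, so its uniform derivative integrates to
   0. *)
have parts k : Jint (fun x => tau k i x * pderiv j psi x) = - Jint (fun x => dtau k i j x * psi x).
  have [_ _ bt] := tau_cc k i; have [_ _ bd] := dtau_cc k i j.
  have ud := udiff_mul bt bd b0 (tau_udiff k i j) dpsi.
  have c2 : cc 1 (fun x => tau k i x * psi x) by exact: cc_mul (tau_cc k i) b0.
  have := Jint_lin 1 (cd k) (ct k).
  under eq_fun do rewrite mul1r.
  rewrite (Jint_udiff c2 _ ud); last first.
    by have := cc_lin 1 (cd k) (ct k); under eq_fun do rewrite mul1r.
  rewrite mul1r => /esym/eqP; rewrite addr_eq0 => /eqP ->; by rewrite opprK.
pose w k (x : 'rV[R]_n) := s k * (tau k i x * pderiv j psi x).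
have wcc k : cc 1 (w k) by exact: cc_scale (ct k).
have ser N : series (fun m => Jint (h m)) N = - Jint (fun x => \sum_(0 <= k < N) w k x).
  have [_ ->] := Jint_sum N wcc; rewrite /series /= -sumrN; apply: eq_bigr => k _.
  rewrite (JintZ _ (ct k)) parts mulrN opprK -(JintZ _ (cd k)).
  by congr Jint; apply/funext => x; rewrite /h /grad_gen mulrA.
apply/cvgrPdist_le => e e0.
(* The constant is the volume of the box [-1, 1]^n times a bound for the derivative of psi. *)
have := tail_small ((2 * 1) ^+ n * B') e0; apply: filterS => N HN.
rewrite ser opprK addrC; have [cS _] := Jint_sum N wcc.
rewrite -mulN1r addrC -(Jint_lin _ cu cS).
apply: le_trans HN; rewrite -[leRHS]mulrA.
apply: (Jint_bound (cc_lin (-1) cu cS)) => x.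
have -> : -1 * (ucomp i x * pderiv j psi x) + \sum_(0 <= k < N) w k x =
   - ((ucomp i x - \sum_(0 <= k < N) tau k i x * s k) * pderiv j psi x).
  rewrite mulrBl mulr_suml mulN1r opprB addrC; congr (_ - _).
  by apply: eq_bigr => k _; rewrite /w; ring.
rewrite normrN normrM mulrC; apply: ler_pM => //; exact: uu_tail.
Qed.

Lemma sqrt_sum_sqr_le (a : 'I_n -> 'I_n -> R) (c : R) : 0 <= c ->
  (forall i j, `|a i j| <= c) ->
  Num.sqrt (\sum_(i < n) \sum_(j < n) a i j ^+ 2) <= n%:R * c.
Proof.
move=> c0 ac; rewrite -[leRHS]ger0_norm ?mulr_ge0// -sqrtr_sqr ler_wsqrtr//.
apply: (@le_trans _ _ (\sum_(i < n) \sum_(j < n) c ^+ 2)).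
  apply: ler_sum => i _; apply: ler_sum => j _; rewrite -(real_normK (num_real _)).
  by apply: lerXn2r; rewrite ?nnegrE.
rewrite !sumr_const !card_ord -mulrnA -[leLHS]mulr_natl exprMn.
by rewrite ler_wpM2r ?sqr_ge0// natrM -expr2.
Qed.

Lemma umap_V1p : V1p p umap.
Proof.
have E i : (fun x => umap x ord0 i) = ucomp i by apply/funext => x; rewrite mxE.
split; first by move=> i; rewrite E; exact: uu_loc_int.
exists grad; split; first by move=> i j; rewrite E; exact: uu_weak.
have [C C0 HC] := dtau_chi; have l0 := lam0; have l2 := lam2; have p1' := p1.
pose c k := (n%:R * C) `^ p * (s k * lam ^- k) `^ p.
have c0 k : 0 <= c k by rewrite mulr_ge0 ?powR_ge0.
have ccc k : cc 1 (fun x => c k * chi k x) by exact: cc_scale (chi_cc k).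
apply: (@le_lt_trans _ _ (iint (fun x => (\sum_(0 <= k <oo) (c k * chi k x)%:E)%E))).
  apply: iint_le => x; first by rewrite lee_fin powR_ge0.
  pose i0 := Ordinal n0.
  pose F (ij : 'I_n * 'I_n) := `|grad ij.1 ij.2 x|.
  (* Disjointness of generations is known entry by entry. Working with the largest entry fixes one
     generation k at x and still controls the whole matrix up to the factor n. *)
  have [[i j] _ /= Hmax] := @arg_maxP _ R _ (i0, i0) predT F isT.
  have Hle : Num.sqrt (\sum_(i < n) \sum_(j < n) grad i j x ^+ 2) <= n%:R * `|grad i j x|.
    by apply: sqrt_sum_sqr_le => // i' j'; exact: (Hmax (i', j') isT).
  have [g0|gn] := eqVneq (grad i j x) 0.
    rewrite g0 normr0 mulr0 in Hle.
    have -> : Num.sqrt (\sum_(i < n) \sum_(j < n) grad i j x ^+ 2) = 0.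
      by apply/eqP; rewrite eq_le Hle sqrtr_ge0.
    rewrite powR0; last by rewrite gt_eqF//; lra.
    by apply: nneseries_ge0 => k _ _; rewrite lee_fin mulr_ge0 ?chi_ge0.
  have [k fkn gE] := dsum_ex gn.
  apply: (@le_trans _ _ (c k * chi k x)%:E); last first.
    rewrite (@nneseriesD1 _ _ k)//; last by move=> m _; rewrite lee_fin mulr_ge0 ?chi_ge0.
    rewrite leeDl//; apply: nneseries_ge0 => m _ _; by rewrite lee_fin mulr_ge0 ?chi_ge0.
  have ch1 : chi k x = 1.
    rewrite /chi big1// => l _.
    apply: (iter_Tr_one lam0 lam2 (k := 1)) => //; first exact: rh_supp.
      by move=> t /(W_half lam0 lam2) /(rho_near lam2)[].
    by rewrite addn1; exact: dtau_W (fk_dtau fkn) l.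
  have t0 : 0 <= s k * lam ^- k by rewrite mulr_ge0 ?s_ge0// invr_ge0 exprn_ge0// ltW.
  rewrite lee_fin ch1 mulr1 /c -powRM ?(mulr_ge0 (ler0n _ _) C0)//.
  apply: ge0_ler_powR; rewrite ?nnegrE ?sqrtr_ge0//; first lra.
    by rewrite mulr_ge0// mulr_ge0.
  apply: (le_trans Hle); rewrite -mulrA ler_wpM2l// [grad i j x]gE /grad_gen normrM (ger0_norm (s_ge0 k)).
  rewrite mulrCA; apply: ler_wpM2l; first exact: s_ge0.
  by have := HC k i j x; rewrite ch1 mulr1 mulrC.
rewrite (iint_series ccc); last by move=> m x; rewrite mulr_ge0 ?chi_ge0.
apply: (@nnseries_lt _ _ ((n%:R * C) `^ p * `|int1 rh| ^+ n * A)).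
  by move=> m; apply: (Jint_ge0 (ccc m)) => x; rewrite mulr_ge0 ?chi_ge0.
move=> N; apply: (@le_trans _ _ ((n%:R * C) `^ p * `|int1 rh| ^+ n *
   \sum_(0 <= k < N) (s k * lam ^- k) `^ p * (2 * lam) ^+ (k * n))); last first.
  by apply: ler_wpM2l => //; rewrite mulr_ge0 ?powR_ge0 ?exprn_ge0.
rewrite mulr_sumr; apply: ler_sum => k _.
rewrite (JintZ _ (chi_cc k)) Jint_chi /c.
have -> : (n%:R * C) `^ p * `|int1 rh| ^+ n * ((s k * lam ^- k) `^ p * (2 * lam) ^+ (k * n)) =
  (n%:R * C) `^ p * (s k * lam ^- k) `^ p * ((2 * lam) ^+ (k * n) * `|int1 rh| ^+ n) by ring.
apply: ler_wpM2l; first by rewrite mulr_ge0 ?powR_ge0.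
apply: ler_wpM2l; first by rewrite exprn_ge0//; lra.
by rewrite -normrX ler_norm.
Qed.

(** By [Q_orbit] the factors of [tau k i] in the other coordinates are 1 and factor i is the sign of
    its k-th digit: u replaces the weights lam^k / 2 by s_k. *)
Lemma umap_yE d : umap (yE lam n d) = \row_i ssum s (fun k => sgn R (digits n d i k)).
Proof.
apply/rowP => i; rewrite !mxE; congr ssum; apply/funext => k; rewrite /tau.
have val l : gen lam k (sign_at i l) rh (yE lam n d ord0 l) = if digits n d l k then 1 else sign_at i l.
  rewrite mxE; apply: (Q_orbit lam0 lam2 (e := digits n d l)
    (x := fun j => cpt lam (fun k => digits n d l (j + k)%N))).
  - exact: rh_supp.
  - by move=> t /(W_half lam0 lam2) /(rho_near lam2)[].
  - by move=> j; exact: cpt_norm.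
  - by move=> j; exact: cpt_orbit.
rewrite (bigD1 i)//= val big1 ?mulr1; last first.
  by move=> l li; rewrite val /sign_at (negPf li) if_same.
by rewrite /sign_at eqxx /sgn.
Qed.

End Map.

(** * The choice of parameters: energy bound and comparison with the gauge *)

Section Exponents.
Variable R : realType.
Implicit Types (x p : R).

Lemma powR_exprn x p k : 0 <= x -> (x ^+ k) `^ p = (x `^ p) ^+ k.
Proof.
move=> x0; elim: k => [|k IH]; first by rewrite !expr0 powR1.
by rewrite !exprS powRM ?IH ?exprn_ge0.
Qed.

Lemma powR2D x y : (2 : R) `^ x * 2 `^ y = 2 `^ (x + y).
Proof. by rewrite powRD// pnatr_eq0 implybT. Qed.

Lemma powR2_half x : 1 < x -> (2 : R) `^ (- x) < 2^-1.
Proof.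
move=> x1; rewrite -ltr_ln ?posrE ?powR_gt0 ?invr_gt0// ln_powR lnV ?posrE//.
have l2 : 0 < ln (2 : R) by rewrite ln_gt0// ltr1n.
nra.
Qed.

Lemma sum_inv_sqr N : \sum_(0 <= k < N) (k.+1%:R ^- 2 : R) <= 2.
Proof.
(* The sharper bound telescopes, as m^-2 <= 2/m - 2/(m+1) for m >= 1. *)
suff : \sum_(0 <= k < N) (k.+1%:R ^- 2 : R) <= 2 - 2 / N.+1%:R.
  by move=> h; apply: (le_trans h); rewrite gerBl divr_ge0.
elim: N => [|N IH]; first by rewrite big_nil invr1; lra.
rewrite big_nat_recr//=; apply: (le_trans (lerD IH (lexx _))).
have m1 : (1 : R) <= N.+1%:R by rewrite ler1n.
have -> : (N.+2%:R : R) = N.+1%:R + 1 by rewrite -[N.+2]addn1 natrD.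
set m := N.+1%:R in m1 *.
have -> : 2 - 2 / (m + 1) = 2 - 2 / m + 2 / (m * (m + 1)) by field; lra.
rewrite lerD2l ler_pdivlMr; last by nra.
have -> : m ^- 2 * (m * (m + 1)) = 1 + m^-1 by field; lra.
have : m^-1 <= 1 by rewrite invf_le1//; lra.
by rewrite -[2]/(1 + 1) lerD2l.
Qed.

Variables (n : nat) (p alpha : R).
Hypotheses (np : n%:R < p) (alpha0 : 0 < alpha) (alphan : alpha < n%:R).

Let sigma := p * alpha / (p + alpha - n%:R).

Lemma sigma_gt0 : 0 < sigma.
Proof.
have h1 := np; have h2 := alpha0; have h3 := alphan.
by rewrite /sigma divr_gt0//; [rewrite mulr_gt0//; lra|lra].
Qed.

Lemma dim_gt0 : (0 < n)%N.
Proof. by rewrite -(ltr0n R); exact: lt_trans alphan. Qed.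

(** Equivalent to (p - n) (n - alpha) > 0. It makes mu smaller than 1/2, hence the pieces of the
    image separated. *)
Lemma sigma_lt_dim : 1 < n%:R / sigma.
Proof.
have h1 := np; have h2 := alpha0; have h3 := alphan.
rewrite ltr_pdivlMr ?sigma_gt0// mul1r /sigma ltr_pdivrMr; [nra|lra].
Qed.

Definition lam_of : R := 2 `^ (- (n%:R / alpha)).
Definition mu_of : R := 2 `^ (- (n%:R / sigma)).
Definition side_exp : R := 1 + sigma^-1.
Definition side (k : nat) : R := mu_of ^+ k * k.+1%:R `^ (- side_exp).

Lemma lamp_gt0 : 0 < lam_of. Proof. exact: powR_gt0. Qed.
Lemma mup_gt0 : 0 < mu_of. Proof. exact: powR_gt0. Qed.

Lemma lamp_half : lam_of < 2^-1.
Proof. by apply: powR2_half; rewrite ltr_pdivlMr// mul1r. Qed.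

Lemma mup_half : mu_of < 2^-1.
Proof. by apply: powR2_half; exact: sigma_lt_dim. Qed.

Lemma lamp_powR : lam_of `^ alpha = 2 ^- n.
Proof.
rewrite -powRrM mulNr mulfVK ?gt_eqF// powR_invn//.
Qed.

Lemma mup_powR : mu_of `^ sigma = 2 ^- n.
Proof.
rewrite -powRrM mulNr mulfVK ?gt_eqF ?sigma_gt0// powR_invn//.
Qed.

Lemma expo_gt0 : 0 < side_exp.
Proof. by rewrite addr_gt0// invr_gt0 sigma_gt0. Qed.

Lemma seqp_gt0 k : 0 < side k.
Proof. by rewrite mulr_gt0 ?exprn_gt0 ?mup_gt0// powR_gt0. Qed.

Lemma powRN_anti (a b e : R) : 0 < a -> a <= b -> 0 <= e -> b `^ (- e) <= a `^ (- e).
Proof.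
move=> a0 ab e0; rewrite !powRN lef_pV2 ?posrE ?powR_gt0//; last exact: lt_le_trans ab.
by apply: ge0_ler_powR => //; rewrite nnegrE ?(ltW a0)// (le_trans (ltW a0)).
Qed.

Lemma seqp_geo : geo mu_of side.
Proof.
split=> k; first exact: ltW (seqp_gt0 k).
rewrite /side exprS mulrA -!mulrA ler_pM2l ?mup_gt0// ler_pM2l ?exprn_gt0 ?mup_gt0//.
by apply: powRN_anti; rewrite ?ler_nat// ltW// expo_gt0.
Qed.

Lemma seqp_le k : side k <= mu_of ^+ k.
Proof.
rewrite -[leRHS]mulr1 ler_pM2l ?exprn_gt0 ?mup_gt0//.
have := @powRN_anti 1 k.+1%:R side_exp; rewrite powR1 => -> //; first by rewrite ler1n.
exact: ltW expo_gt0.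
Qed.

(** In base-2 logarithms this is p / sigma = 1 + (p - n) / alpha, the definition of sigma. *)
Lemma critical_ratio : mu_of `^ p * lam_of^-1 `^ p * (2 * lam_of) ^+ n = 1.
Proof.
have h1 := np; have h2 := alpha0; have h3 := alphan.
have -> : lam_of^-1 = 2 `^ (n%:R / alpha) by rewrite /lam_of powRN invrK.
rewrite -[X in _ * (X * lam_of) ^+ n](@powRr1 _ 2)// powR2D -powR_mulrn ?powR_ge0//.
rewrite -!powRrM !powR2D.
have -> : - (n%:R / sigma) * p + n%:R / alpha * p + (1 - n%:R / alpha) * n%:R = 0.
  rewrite /sigma; field; apply/and3P; split; apply/eqP; lra.
by rewrite powRr0.
Qed.

Lemma seqp_energy N :
  \sum_(0 <= k < N) (side k * lam_of ^- k) `^ p * (2 * lam_of) ^+ (k * n) <= 2.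
Proof.
have h1 := np; have h2 := alpha0; have h3 := alphan.
have n1 : (1 : R) <= n%:R by rewrite ler1n dim_gt0.
apply: le_trans (sum_inv_sqr N); apply: ler_sum => k _.
have m0 := ltW mup_gt0; have l0 := ltW lamp_gt0.
rewrite -(exprVn lam_of k) /side !powRM ?mulr_ge0 ?exprn_ge0 ?powR_ge0 ?invr_ge0//.
rewrite !powR_exprn ?invr_ge0// mulnC exprM.
have -> : (mu_of `^ p) ^+ k * (k.+1%:R `^ (- side_exp)) `^ p * (lam_of^-1 `^ p) ^+ k * ((2 * lam_of) ^+ n) ^+ k =
   (mu_of `^ p * lam_of^-1 `^ p * (2 * lam_of) ^+ n) ^+ k * (k.+1%:R `^ (- side_exp)) `^ p.
  by rewrite !exprMn; ring.
rewrite critical_ratio expr1n mul1r -powRrM -powR_invn//.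
apply: ler_powR; first by rewrite ler1n.
rewrite mulNr lerN2 /side_exp mulrDl mul1r.
have -> : sigma^-1 * p = 1 + (p - n%:R) / alpha.
  rewrite /sigma; field; apply/and3P; split; apply/eqP; lra.
have : 0 <= (p - n%:R) / alpha by rewrite divr_ge0//; lra.
lra.
Qed.

Lemma seqp_powR k : side k `^ sigma = 2 ^- (n * k) * k.+1%:R `^ (- (sigma + 1)).
Proof.
have m0 := ltW mup_gt0.
rewrite /side powRM ?exprn_ge0 ?powR_ge0// powR_exprn// mup_powR exprVn exprM -powRrM.
congr (_ * _ `^ _); rewrite /side_exp; have s0 := sigma_gt0; field; lra.
Qed.

(** The logarithm of 1 / (c s_k) grows at least linearly in k, while s_k^sigma is 2^-(n k) times
    (k+1)^-(sigma+1). So phi (c s_k) exceeds a multiple of 2^-(n k) (k+1)^kap with kap > 0, and this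
    beats every M. *)
Lemma gauge_dominates (gamma c0 r0 c M : R) (phi : R -> R) :
  1 + sigma < gamma -> 0 < c0 -> 0 < r0 -> 0 < c -> c <= 1 ->
  (forall r, 0 < r -> r < r0 -> c0^-1 * (r `^ sigma * ln r^-1 `^ gamma) <= phi r) ->
  exists K, forall k, (K <= k)%N -> M * 2 ^- (n * k) <= phi (c * side k).
Proof.
move=> g1 c00 r00 c_0 c_1 Hphi.
have s0 := sigma_gt0; have m0 := mup_gt0; have m2 := mup_half.
pose L := ln mu_of^-1.
have L0 : 0 < L by rewrite ln_gt0// -[ltLHS]invr1 ltf_pV2 ?posrE//; lra.
pose kap := gamma - (sigma + 1).
have kap0 : 0 < kap by rewrite /kap; lra.
pose C := c0^-1 * c `^ sigma * (L / 2) `^ gamma.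
have C0 : 0 < C by rewrite !mulr_gt0 ?powR_gt0 ?invr_gt0// divr_gt0.
have [K1 HK1] : exists K1, forall k, (K1 <= k)%N -> c * side k < r0.
  have h : @GRing.exp R mu_of @ \oo --> (0 : R).
    by apply: cvg_expr; rewrite gtr0_norm//; lra.
  have /cvgrPdist_lt/(_ r0 r00)[N _ HN] := h.
  exists N => k Nk; have := HN k Nk.
  rewrite /= sub0r normrN ger0_norm ?exprn_ge0//; last exact: ltW.
  apply: le_lt_trans; apply: le_trans (seqp_le k).
  by rewrite ler_piMl// ltW// seqp_gt0.
pose K2 := (Num.truncn ((`|M| / C) `^ kap^-1)).+1.
(* k >= 1 gives k >= (k+1)/2, hence the slope L / 2; K1 brings c s_k into the range where phi is
   controlled; K2 makes C (k+1)^kap at least M. *)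
exists (maxn 1 (maxn K1 K2)) => k; rewrite !geq_max => /and3P[k1 kK1 kK2].
have sk := seqp_gt0 k.
have gk : 0 < c * side k by rewrite mulr_gt0.
apply: le_trans (Hphi _ gk (HK1 k kK1)).
rewrite powRM ?(ltW c_0) ?(ltW sk)// seqp_powR.
have q1 : (1 : R) <= k%:R by rewrite ler1n.
have kS : (k.+1%:R : R) = k%:R + 1 by rewrite -[k.+1]addn1 natrD.
have lnl : k.+1%:R * (L / 2) <= ln (c * side k)^-1.
  apply: (@le_trans _ _ (ln (mu_of ^+ k)^-1)).
    rewrite -exprVn lnXn ?invr_gt0// -/L -[leRHS]mulr_natl kS; nra.
  rewrite ler_ln ?posrE ?invr_gt0 ?exprn_gt0// lef_pV2 ?posrE ?exprn_gt0//.
  apply: le_trans (seqp_le k); by rewrite ler_piMl// ltW.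
have lng : k.+1%:R `^ gamma * (L / 2) `^ gamma <= ln (c * side k)^-1 `^ gamma.
  have L20 : 0 <= L / 2 by rewrite divr_ge0// ltW.
  have kL : 0 <= k.+1%:R * (L / 2) by rewrite mulr_ge0.
  rewrite -powRM//; apply: ge0_ler_powR => //; first lra.
  by rewrite nnegrE; exact: le_trans lnl.
have MC : M <= C * k.+1%:R `^ kap.
  have h : (`|M| / C) `^ kap^-1 <= k.+1%:R.
    have /truncn_itv/andP[_ /ltW h] : 0 <= (`|M| / C) `^ kap^-1 by exact: powR_ge0.
    apply: (le_trans h); rewrite ler_nat; exact: leqW.
  have h2 : `|M| / C <= k.+1%:R `^ kap.
    have MC0 : 0 <= `|M| / C by rewrite divr_ge0// ltW.
    rewrite -[leLHS]powRr1// -[X in _ `^ X](mulVf (lt0r_neq0 kap0)) powRrM.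
    by apply: ge0_ler_powR; rewrite ?nnegrE ?powR_ge0// ltW.
  by apply: (le_trans (ler_norm M)); rewrite mulrC -ler_pdivrMr.
have kapE : k.+1%:R `^ kap = k.+1%:R `^ gamma * k.+1%:R `^ (- (sigma + 1)).
  by rewrite -powRD// pnatr_eq0 implybT.
apply: (@le_trans _ _ (C * k.+1%:R `^ kap * 2 ^- (n * k))).
  by apply: ler_wpM2r => //; rewrite invr_ge0 exprn_ge0.
rewrite kapE /C.
have -> : c0^-1 * c `^ sigma * (L / 2) `^ gamma *
    (k.+1%:R `^ gamma * k.+1%:R `^ (- (sigma + 1))) * 2 ^- (n * k) =
  c0^-1 * (c `^ sigma * (2 ^- (n * k) * k.+1%:R `^ (- (sigma + 1))) *
    (k.+1%:R `^ gamma * (L / 2) `^ gamma)) by ring.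
apply: ler_wpM2l; first by rewrite invr_ge0 ltW.
apply: ler_wpM2l => //.
by rewrite !mulr_ge0 ?powR_ge0// invr_ge0 exprn_ge0.
Qed.

End Exponents.

Theorem theorem6p1 (R : realType) (n : nat) (p alpha gamma : R)
  (phi : R -> R) :
  n%:R < p -> 0 < alpha -> alpha < n%:R ->
  1 + p * alpha / (p + alpha - n%:R) < gamma ->
  gauge phi ->
  (exists c r0 : R, 0 < c /\ 0 < r0 /\
     forall r, 0 < r -> r < r0 ->
       c^-1 * (r `^ (p * alpha / (p + alpha - n%:R)) * ln (r^-1) `^ gamma)
         <= phi r /\
       phi r <= c * (r `^ (p * alpha / (p + alpha - n%:R)) * ln (r^-1) `^ gamma)) ->
  exists u : 'rV[R]_n -> 'rV[R]_n,
    continuous u /\ V1p p u /\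
    exists E : set 'rV[R]_n,
      compact E /\
      (0%E < hausdorff (fun r : R => (r `^ alpha)%R) E)%E /\
      (hausdorff (fun r : R => (r `^ alpha)%R) E < +oo)%E /\
      hausdorff phi (u @` E) = +oo%E.
Proof.
move=> np al0 aln hg gphi [c0 [r0 [c00 [r00 Hphi]]]].
have n0 := dim_gt0 al0 aln.
have l0 := lamp_gt0 n alpha; have l2 := lamp_half al0 aln.
have m0 := mup_gt0 n p alpha; have m2 := mup_half np al0 aln.
have gs := seqp_geo np al0 aln.
have n1 : (1 : R) <= n%:R by rewrite ler1n.
have p1 : 1 <= p by lra.
have en := seqp_energy np al0 aln.
pose lam := lam_of n alpha; pose s := side n p alpha.
exists (umap lam s); split; first exact: (umap_continuous l0 l2 m0 m2 gs).
split; first exact: (umap_V1p l0 l2 m0 m2 gs n0 p1 en).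
exists (@CE R lam n); split; first exact: CE_compact.
split; first exact: (hausdorff_CE_gt0 l0 l2 al0 (lamp_powR n al0) n0).
split; first exact: (hausdorff_CE_fin l0 l2 al0 (lamp_powR n al0) n0).
have [phi_lt _ phi0 _] := gphi.
have phi_le (x y : R) : 0 <= x -> x <= y -> phi x <= phi y.
  move=> x0; rewrite le_eqVlt => /predU1P[->//|xy]; apply/ltW/phi_lt => //.
    by rewrite in_itv /= x0.
  by rewrite in_itv /= (le_trans x0 (ltW xy)).
pose mu := mu_of n p alpha.
have c1 : 0 < 1 - 2 * mu by rewrite /mu; lra.
have c1' : 1 - 2 * mu <= 1 by rewrite /mu; lra.
(* The mass distribution principle holds here with every M, only the starting generation K depending
   on it; this forces the measure to be infinite. *)
have Hlow (M : R) : 0 <= M -> ((M / 2)%:E <= hausdorff phi (umap lam s @` @CE R lam n))%E.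
  move=> M0.
  have [K HK] := gauge_dominates np al0 aln M hg c00 r00 c1 c1'
    (fun r h1 h2 => (Hphi r h1 h2).1).
  apply: (@mass_distribution R n phi M (fun d => umap lam s (yE lam n d)) _
    (fun k => (1 - 2 * mu) * s k) K) => //.
  - by move=> d; exists (yE lam n d) => //; exact: yE_CE.
  - by move=> k; rewrite mulr_gt0// seqp_gt0.
  - by move=> j k jk; rewrite ler_wpM2l ?(ltW c1)//; exact: (geo_anti m2 gs).
  - move=> e e0.
    have h : @GRing.exp R mu @ \oo --> (0 : R).
      by apply: cvg_expr; rewrite gtr0_norm//; rewrite /mu; lra.
    have /cvgrPdist_lt/(_ e e0)[N _ HN] := h.
    exists N; have := HN N (leqnn N).
    rewrite /= sub0r normrN ger0_norm ?exprn_ge0// ?(ltW m0)//.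
    apply: le_lt_trans; apply: le_trans (seqp_le np al0 aln N).
    by rewrite ler_piMl// ltW// seqp_gt0.
  - move=> d d' k i ik dd; rewrite !umap_yE//.
    exact: (digits_sep m0 m2 gs ik dd).
  (* The principle compares mass and gap at generation k + 1, which is also beyond K. *)
  - by move=> k Kk; apply: HK; exact: leqW.
apply/eqyP => A A0; have := Hlow (A * 2).
by rewrite mulfK//; apply; rewrite mulr_ge0// ltW.
Qed.
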